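(* Let $\alpha\in(0,2)$, $\lambda_n(x)=\left(\dfrac{ix-1}{ix+1}\right)^n$ for $n\in\mathbb Z$, and, for $n=0,1,2,\ldots$ and $x\in\mathbb R$, $$\mathrm{CH}_{2n}(x)=\frac{\lambda_n(x)+\lambda_{-n}(x)}{2},\qquad \mathrm{SH}_{2n+1}(x)=\frac{\lambda_{n+1}(x)-\lambda_{-n-1}(x)}{2i}.$$ Then, for every $x\in\mathbb R$: (i) $(-\Delta)^{\alpha/2}\mathrm{CH}_0(x)=0$; $$(-\Delta)^{\alpha/2}\mathrm{CH}_2(x)=-\frac{2\Gamma(1+\alpha)}{(1+x^2)^{(1+\alpha)/2}}\sin\left((1+\alpha)\,\mathrm{arccot}(x)-\frac{\pi\alpha}{2}\right);$$ and, for $n=2,3,4,\ldots$, $$ \begin{aligned} (-\Delta)^{\alpha/2}\mathrm{CH}_{2n}(x)={}&-\frac{2n\Gamma(1+\alpha)}{(1+x^2)^{(n+\alpha)/2}}\sin\left((n+\alpha)\,\mathrm{arccot}(x)-\frac{\pi\alpha}{2}\right)\\ &\quad\times\sum_{l=0}^{\lfloor\frac{n-1}{2}\rfloor}(-1)^l\binom{n-1}{2l}x^{n-1-2l}\,{}_2F_1(-2l,1+\alpha;2;2)\\ &+\frac{2n\Gamma(1+\alpha)}{(1+x^2)^{(n+\alpha)/2}}\cos\left((n+\alpha)\,\mathrm{arccot}(x)-\frac{\pi\alpha}{2}\right)\\ &\quad\times\sum_{l=0}^{\lfloor\frac{n-2}{2}\rfloor}(-1)^l\binom{n-1}{2l+1}x^{n-2-2l}\,{}_2F_1(-2l-1,1+\alpha;2;2).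 \end{aligned} $$ (ii) $$(-\Delta)^{\alpha/2}\mathrm{SH}_1(x)=\frac{2\Gamma(1+\alpha)}{(1+x^2)^{(1+\alpha)/2}}\cos\left((1+\alpha)\,\mathrm{arccot}(x)-\frac{\pi\alpha}{2}\right);$$ and, for $n=1,2,3,\ldots$, $$ \begin{aligned} (-\Delta)^{\alpha/2}\mathrm{SH}_{2n+1}(x)={}&\frac{2(n+1)\Gamma(1+\alpha)}{(1+x^2)^{(n+1+\alpha)/2}}\cos\left((n+1+\alpha)\,\mathrm{arccot}(x)-\frac{\pi\alpha}{2}\right)\\ &\quad\times\sum_{l=0}^{\lfloor\frac{n}{2}\rfloor}(-1)^l\binom{n}{2l}x^{n-2l}\,{}_2F_1(-2l,1+\alpha;2;2)\\ &+\frac{2(n+1)\Gamma(1+\alpha)}{(1+x^2)^{(n+1+\alpha)/2}}\sin\left((n+1+\alpha)\,\mathrm{arccot}(x)-\frac{\pi\alpha}{2}\right)\\ &\quad\times\sum_{l=0}^{\lfloor\frac{n-1}{2}\rfloor}(-1)^l\binom{n}{2l+1}x^{n-1-2l}\,{}_2F_1(-2l-1,1+\alpha;2;2). \end{aligned} $$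
   Context: For $\alpha\in(0,2)$ the one-dimensional fractional Laplacian of a (possibly complex-valued) function $u$ on $\mathbb R$ is $$(-\Delta)^{\alpha/2}u(x)=c_\alpha\int_{-\infty}^\infty\frac{u(x)-u(x+y)}{|y|^{1+\alpha}}\,dy,\qquad c_\alpha=\alpha\,\frac{2^{\alpha-1}\Gamma(1/2+\alpha/2)}{\sqrt\pi\,\Gamma(1-\alpha/2)},$$ the integral being understood in the principal value sense at $y=0$; equivalently, for the functions considered here, $(-\Delta)^{\alpha/2}u(x)=\frac{c_\alpha}{\alpha}\int_0^\infty\frac{u'(x-y)-u'(x+y)}{y^\alpha}\,dy$. The function $\mathrm{arccot}$ takes values in $[0,\pi]$: for $x\in\mathbb R$, $\mathrm{arccot}(x)$ is the unique $s\in(0,\pi)$ with $\cot(s)=x$. The convention $x^0=1$ is used, also at $x=0$. The Gaussian hypergeometric function is ${}_2F_1(a,b;c;z)=\sum_{k=0}^\infty\frac{(a)_k(b)_k}{(c)_k}\frac{z^k}{k!}$, where $(w)_0=1$ and $(w)_k=w(w+1)\cdots(w+k-1)$ for $k\ge1$. When $a$ is a nonpositive integer the sum is finite (terms with $k>-a$ vanish), and it is then defined by this finite sum for all $z\in\mathbb C$. *)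

(* Defs.v *)
From HB Require Import structures.
From mathcomp Require Import all_boot all_order all_algebra.
From mathcomp Require Import all_classical all_reals all_analysis.
From mathcomp Require Export complex.
Set Implicit Arguments.
Unset Strict Implicit.
Unset Printing Implicit Defensive.
Import Order.TTheory GRing.Theory Num.Theory.
Import numFieldNormedType.Exports.
Local Open Scope classical_set_scope.
Local Open Scope ring_scope.

Section Definitions.
Variable R : realType.
Local Notation mu := (@lebesgue_measure R).

(* Euler's integral: Gamma s is only meaningful for 0 < s, the only case used. *)
Definition Gamma (s : R) : R :=
  \int[mu]_(t in `]0, +oo[) (t `^ (s - 1) * expR (- t)).

(* cot s is written cos s / sin s; see arccotP and arccotE for
   well-definedness and uniqueness. *)
Definition arccot (x : R) : R :=
  xget 0 [set s | 0 < s < pi /\ cos s / sin s = x].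

Definition pochhammer (w : R) (k : nat) : R := \prod_(i < k) (w + i%:R).

Definition hyp2F1_term (a b c z : R) (k : nat) : R :=
  pochhammer a k * pochhammer b k / pochhammer c k * (z ^+ k / k`!%:R).

(* When a is a nonpositive integer the partial sums are eventually constant,
   so this is the finite sum, for every z: see hyp2F1_poly. *)
Definition hyp2F1 (a b c z : R) : R := limn (series (hyp2F1_term a b c z)).

(* The principal value at 0, over the whole real line: truncations |y| > eps
   are Lebesgue integrable, and their integrals converge as eps -> 0+. *)
Definition is_pv_integral (f : R -> R) (l : R) : Prop :=
  (forall eps : R, 0 < eps ->
     mu.-integrable [set y | eps < `|y|] (EFin \o f)) /\
  \int[mu]_(y in [set y | eps < `|y|]) f y @[eps --> 0^'+] --> l.

(* Complex-valued integrals are taken componentwise. *)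
Definition is_pv_integralC (f : R -> R[i]) (l : R[i]) : Prop :=
  is_pv_integral (fun y => complex.Re (f y)) (complex.Re l) /\
  is_pv_integral (fun y => complex.Im (f y)) (complex.Im l).

Definition fracLaplacian_const (alpha : R) : R :=
  alpha * (2 `^ (alpha - 1) * Gamma (1 / 2 + alpha / 2) /
           (Num.sqrt pi * Gamma (1 - alpha / 2))).

(* The fractional Laplacian of order alpha / 2 of u exists at x and equals v. *)
Definition is_fracLaplacian (alpha : R) (u : R -> R[i]) (x : R) (v : R[i]) :
    Prop :=
  exists I : R[i],
    is_pv_integralC
      (fun y => (u x - u (x + y)) / (`|y| `^ (1 + alpha))%:C%C) I /\
    v = (fracLaplacian_const alpha)%:C%C * I.

Definition lambda (n : int) (x : R) : R[i] :=
  (('i%C * x%:C%C - 1) / ('i%C * x%:C%C + 1)) ^ n.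

(* CH_even n is CH_{2n}, and SH_odd n is SH_{2n+1}. *)
Definition CH_even (n : nat) (x : R) : R[i] :=
  (lambda n%:Z x + lambda (- n%:Z) x) / 2.

Definition SH_odd (n : nat) (x : R) : R[i] :=
  (lambda n.+1%:Z x - lambda (- n.+1%:Z) x) / (2 * 'i%C).

Lemma arccot_unique (x s : R) :
  0 < s < pi -> cos s / sin s = x -> s = pi / 2 - atan x.
Proof.
move=> /andP[s0 spi] sx.
have -> : x = tan (pi / 2 - s).
  by rewrite /tan [X in X / _]sinB [X in _ / X]cosB sin_pihalf cos_pihalf
     !mul0r !mul1r subr0 add0r.
rewrite tanK ?subKr// in_itv/=; apply/andP; split.
  by rewrite ltrBrDr addrC -ltrBrDr opprK -splitr.
by rewrite ltrBlDr ltrDl.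
Qed.

Lemma arccotP (x : R) :
  0 < arccot x < pi /\ cos (arccot x) / sin (arccot x) = x.
Proof.
rewrite /arccot; case: xgetP => [y _ //|] /(_ (pi / 2 - atan x)) []; split.
  rewrite subr_gt0 atan_ltpi2 ltrBlDr -ltrBlDl {2}[pi]splitr.
  by rewrite opprD addrA subrr sub0r atan_gtNpi2.
rewrite cosB sinB sin_pihalf cos_pihalf !mul0r !mul1r subr0 add0r.
by rewrite -[RHS]atanK.
Qed.

Lemma arccotE (x : R) : arccot x = pi / 2 - atan x.
Proof. by have [? ?] := arccotP x; apply: arccot_unique. Qed.

Lemma hyp2F1_poly (m : nat) (b c z : R) :
  hyp2F1 (- m%:R) b c z = \sum_(0 <= k < m.+1) hyp2F1_term (- m%:R) b c z k.
Proof.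
apply: lim_near_cst => //; near=> n.
have mn : (m < n)%N by near: n; exact: nbhs_infty_gt.
rewrite /series/= (big_cat_nat (n := m.+1))//=.
rewrite [X in _ + X](_ : _ = 0) ?addr0// big_nat; apply: big1 => k /andP[mk _].
rewrite /hyp2F1_term /pochhammer (bigD1 (Ordinal mk))//=.
by rewrite addNr !mul0r.
Unshelve. all: by end_near.
Qed.

End Definitions.

(* Main.v *)
(** [lambda_n x = (1 - 2 / (1 + i x)) ^ n] is a linear combination of the powers
    [(1 + i x) ^ (- k)], and [Gamma s * (1 + i x) ^ (- s)] is
    [\int_0^oo t ^ (s - 1) e^(- t) e^(- i t x) dt].
    The fractional Laplacian multiplies the density of such a one-sided Fourier
    integral by [t ^ alpha], hence maps [(1 + i x) ^ (- k)] to
    [Gamma (k + alpha) / Gamma k * (1 + i x) ^ (- k - alpha)].  This rests on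
    Fubini's theorem and on the value
    [\int_0^oo (1 - cos (t y)) y ^ (- 1 - alpha) dy = t ^ alpha / (2 c_alpha)],
    which follows by scaling up to a constant; the constant is found by
    integrating both sides against [e^(- t^2)], whose cosine transform is known.
    The resulting sum over [k] is expanded around [x - i = - i (1 + i x)], which
    produces the terminating hypergeometric sums. *)
Require Import Defs.
From mathcomp Require Import all_boot all_order all_algebra.
From mathcomp Require Import all_classical all_reals all_analysis.
From mathcomp Require Import measurable_realfun ring lra zify.
Import Order.TTheory GRing.Theory Num.Theory.
Import numFieldNormedType.Exports.
Set Implicit Arguments.
Unset Strict Implicit.
Unset Printing Implicit Defensive.
Local Open Scope classical_set_scope.
Local Open Scope ring_scope.

(** * Calculus on the open half-line *)

Section half_line.
Variable R : realType.
Local Notation mu := (@lebesgue_measure R).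
Implicit Types (f F : R -> R).

(** The principal value need not converge absolutely, which blocks a direct use of Fubini's theorem.
    Folding [y] and [- y] together replaces it by the second difference
    [2 u x - u (x + y) - u (x - y)] on the half-line. On waves of frequency [t] this is
    multiplication by [2 (1 - cos (t y))], of order [min 1 (y ^ 2)] for fixed [t], so
    [0 < alpha < 2] gives absolute convergence. Powers with a non-integer exponent are carried in
    real form: [(1 + i x) ^ (- s)] has modulus [(1 + x ^ 2) ^ (- s / 2)] and argument
    [- s * atan x]. Since [lambda (- n)] is the conjugate of [lambda n], the functions CH and SH are
    real and imaginary parts of such combinations. The Gaussian determines the constant because both
    sides become Gamma integrals: [Gamma ((1 + alpha) / 2)] by scaling, and [Gamma (1 - alpha / 2)]
    after one integration by parts. The argument 2 of the hypergeometric sums is the 2 of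
    [1 - 2 / (1 + i x)]. Their parameter [c = 2] comes from the vanishing constant term of
    [lambda n]'s image: the sum starts at exponent [k + 1], which leaves [(k + 1)!], the Pochhammer
    symbol of 2. *)

Lemma bigcup_itvVy :
  \bigcup_n `[n.+1%:R^-1, +oo[%classic = `]0, +oo[%classic :> set R.
Proof.
apply/seteqP; split => x /=.
  move=> [n _] /=; rewrite !in_itv/= !andbT; apply: lt_le_trans.
  by rewrite invr_gt0 ltr0n.
rewrite in_itv/= andbT => x0; have /ltr_add_invr[n] := x0.
rewrite add0r => nx; exists n => //=.
by rewrite in_itv/= andbT ltW.
Qed.

(** Monotone convergence. It transfers results on closed half-lines to []0, +oo[], where the
    integrands may blow up at 0. *)
Lemma ge0_cvg_integral_itvVy (f : R -> \bar R) :
  measurable_fun (`]0, +oo[ : set R) f ->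
  (forall x : R, (0 < x)%R -> (0 <= f x)%E) ->
  (\int[mu]_(x in `[(n.+1%:R^-1 : R)%R, +oo[) f x @[n --> \oo] -->
   \int[mu]_(x in `]0%R, +oo[) f x)%E.
Proof.
move=> mf f0; rewrite -bigcup_itvVy.
have sub n : `[n.+1%:R^-1, +oo[%classic `<=` (`]0%R, +oo[%classic : set R).
  by move=> x /=; rewrite !in_itv/= !andbT; apply: lt_le_trans;
    rewrite invr_gt0.
apply: ge0_nondecreasing_set_cvg_integral => //.
- apply/nondecreasing_seqP => n; rewrite subsetEset => x/=.
  rewrite !in_itv/= !andbT; apply: le_trans.
  by rewrite lef_pV2 ?posrE// ler_nat.
- by move=> n; exact: (measurable_funS _ (@sub n)).
- by move=> n x /sub/=; rewrite in_itv/= andbT; exact: f0.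
Qed.

Lemma measurable_fun_gt0 f : (forall x : R, 0 < x -> {for x, continuous f}) ->
  measurable_fun (`]0, +oo[ : set R) f.
Proof.
move=> cf; apply: open_continuous_measurable_fun => // x.
by rewrite inE/= in_itv/= andbT; exact: cf.
Qed.

Lemma is_derive_continuous f (x l : R) : is_derive x 1 f l -> {for x,
  continuous f}.
Proof. by move=> [df _]; apply: differentiable_continuous;
  exact/derivable1_diffP. Qed.

Lemma cvg_invS_right (l : R) F : F x @[x --> 0^'+] --> l ->
  F n.+1%:R^-1 @[n --> \oo] --> l.
Proof.
move/cvg_at_rightP; apply; split; first by move=> n; rewrite invr_gt0.
exact: cvg_harmonic.
Qed.

Lemma cvgr_natS : (n.+1%:R : R) @[n --> \oo] --> +oo.
Proof. by have := @cvgr_idn R; rewrite -(cvg_shiftS _ (pinfty_nbhs R)). Qed.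

(** The fundamental theorem on [[1 / (n + 1), +oo[] followed by monotone convergence. Integrability
    is a consequence here, so an explicit antiderivative proves it for a nonnegative function. *)
Lemma ge0_FTC0y f F (A B : R) :
  (forall x : R, 0 < x -> 0 <= f x) ->
  (forall x : R, 0 < x -> {for x, continuous f}) ->
  (forall x : R, 0 < x -> is_derive x 1 F (f x)) ->
  F x @[x --> 0^'+] --> A -> F x @[x --> +oo] --> B ->
  (\int[mu]_(x in `]0%R, +oo[) (f x)%:E = (B - A)%:E)%E.
Proof.
move=> f0 cf dF FA FB.
have mf : measurable_fun (`]0, +oo[ : set R) (EFin \o f).
  apply/measurable_EFinP; exact: measurable_fun_gt0.
have := ge0_cvg_integral_itvVy mf f0.
have -> : (fun n => \int[mu]_(x in `[(n.+1%:R^-1)%R, +oo[) (EFin \o f) x)%E =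
          (fun n => (B - F n.+1%:R^-1)%:E).
  apply/funext => n.
  have n0 : 0 < n.+1%:R^-1 :> R by rewrite invr_gt0.
  rewrite EFinB; apply: ge0_continuous_FTC2y.
  - by move=> x nx; apply: f0; exact: lt_le_trans nx.
  - by apply: continuous_in_subspaceT => x; rewrite inE/= in_itv/= andbT => nx;
    apply: cf; exact: lt_le_trans nx.
  - exact: FB.
  - by move=> x nx; apply: ex_derive; apply: dF; exact: lt_trans nx.
  - by apply: cvg_at_right_filter; apply: is_derive_continuous; exact: dF.
  - move=> x; rewrite in_itv/= andbT => nx; rewrite derive1E.
    by apply: derive_val; apply: dF; exact: lt_trans nx.
move=> /cvg_lim <-//; apply/cvg_lim => //.
by apply: cvg_EFin; [exact: nearW|apply: cvgB;
  [exact: cvg_cst|exact: cvg_invS_right]].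
Qed.

(** Signed version: [|f|] dominates the truncations to compact intervals exhausting the
    half-line. *)
Lemma FTC0y f F (A B : R) :
  mu.-integrable `]0, +oo[ (EFin \o f) ->
  (forall x : R, 0 < x -> {for x, continuous f}) ->
  (forall x : R, 0 < x -> is_derive x 1 F (f x)) ->
  F x @[x --> 0^'+] --> A -> F x @[x --> +oo] --> B ->
  \int[mu]_(x in `]0, +oo[) f x = B - A.
Proof.
move=> intf cf dF FA FB.
have mf : measurable_fun (`]0, +oo[ : set R) f by exact: measurable_fun_gt0.
(* The shift [n.+2] makes the interval nondegenerate: [1 / (n + 2) < 1 < n + 2]. *)
pose I n : set R := `[n.+2%:R^-1, n.+2%:R]%classic.
have I0 n : I n `<=` `]0, +oo[.
  move=> x; rewrite /I /=; rewrite !in_itv/= andbT => /andP[h _];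
    rewrite (lt_le_trans _ h)//.

have H : (\int[mu]_(x in `]0%R, +oo[) (f \_ (I n) x)%:E @[n --> \oo] -->
          \int[mu]_(x in `]0%R, +oo[) (f x)%:E)%E.
  have [|||||_ _] := @dominated_convergence _ _ R mu `]0%R, +oo[%classic
    (measurable_itv _) (fun n => EFin \o (f \_ (I n))) (EFin \o f)
    (abse \o (EFin \o f)) => //.
  - move=> n; apply/measurable_EFinP.
    apply/measurable_restrict => //; first exact: measurable_itv.
    by apply: (measurable_funS _ _ mf) => // x [].
  - exact/measurable_EFinP.
  - apply: aeW => x /=; rewrite in_itv/= andbT => x0.
    apply: cvg_EFin; first exact: nearW.
    apply: cvg_near_cst; near=> n; rewrite /= patchE mem_set// /I/= in_itv/=.
    apply/andP; split.
      rewrite invf_ple ?posrE// ltW//.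
      near: n; have /cvgryPgt := @cvgr_natS.
      by move=> /(_ x^-1)[N _ HN]; exists N => // n /= Nn;
        rewrite (HN n.+1)//= ltnW.
    rewrite ltW//; near: n; have /cvgryPgt := @cvgr_natS.
    by move=> /(_ x)[N _ HN]; exists N => // n /= Nn; rewrite (HN n.+1)//= ltnW.
  - exact: integrable_abse.
  - apply: aeW => x /= n _; rewrite patchE lee_fin; case: ifPn => //.
    by rewrite normr0.
have IE : (fun n => \int[mu]_(x in `]0%R, +oo[) (f \_ (I n) x)%:E)%E =
    (fun n => (F n.+2%:R - F n.+2%:R^-1)%:E).
  apply/funext => n.
  transitivity (\int[mu]_(x in `]0%R, +oo[) ((EFin \o f) \_ (I n)) x)%E.
    by apply: eq_integral => x _; rewrite !patchE; case: ifP.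
  rewrite -integral_mkcondr setIC setIidl ?I0//.
  have n0 : 0 < n.+2%:R^-1 :> R by rewrite invr_gt0.
  rewrite EFinB; apply: continuous_FTC2.
  - by rewrite (@lt_trans _ _ 1)// ?invf_lt1 ?ltr1n.
  - apply: continuous_in_subspaceT => x; rewrite inE => /I0/=.
    by rewrite in_itv/= andbT; exact: cf.
  - split.
    + move=> x; rewrite in_itv/= => /andP[nx _].
      by apply: ex_derive; apply: dF; exact: lt_trans nx.
    + by apply: cvg_at_right_filter; apply: is_derive_continuous; exact: dF.
    + by apply: cvg_at_left_filter; apply: is_derive_continuous; exact: dF.
  - move=> x; rewrite in_itv/= => /andP[nx _]; rewrite derive1E.
    by apply: derive_val; apply: dF; exact: lt_trans nx.
move: H; rewrite IE /Rintegral => /cvg_lim <-//.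
rewrite (_ : lim _ = (B - A)%:E)//.
apply/cvg_lim => //; apply: cvg_EFin; first exact: nearW.
apply: cvgB.
  have /cvg_pinftyP := FB; apply.
  by have := @cvgr_natS; rewrite -(cvg_shiftS _ (pinfty_nbhs R)).
by have := cvg_invS_right FA; rewrite -(cvg_shiftS _ (nbhs A)).
Unshelve. all: by end_near. Qed.

(** The substitution [F] is performed on [[1 / (n + 1), +oo[]. Since [F (1 / (n + 1))] decreases to
    0, both sides then exhaust the open half-line and pass to the limit by monotone convergence. *)
Lemma gt0_increasing_substitution (f F phi : R -> R) (l : R) :
  (forall x : R, 0 < x -> 0 <= f x) ->
  (forall x : R, 0 < x -> {for x, continuous f}) ->
  (forall x : R, 0 < x -> 0 < F x) ->
  (forall x : R, 0 < x -> is_derive x 1 F (phi x)) ->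
  (forall x : R, 0 < x -> 0 <= phi x) ->
  (forall x : R, 0 < x -> {for x, continuous phi}) ->
  phi x @[x --> +oo] --> l ->
  {in `]0, +oo[ &, {homo F : x y / x < y}} ->
  F x @[x --> 0^'+] --> 0 -> F x @[x --> +oo] --> +oo ->
  (\int[mu]_(x in `]0%R, +oo[) (f x)%:E =
   \int[mu]_(x in `]0%R, +oo[) (f (F x) * phi x)%:E)%E.
Proof.
move=> f0 cf Fgt0 dF phi0 cphi phil Fi F0 Fy.
have pos n : 0 < n.+1%:R^-1 :> R by rewrite invr_gt0.
have cF (x : R) : 0 < x -> {for x,
  continuous F} by move=> /dF/is_derive_continuous.
have cfF (x : R) : 0 < x -> {for x, continuous (fun x => f (F x) * phi x)}.
  move=> x0; apply: continuousM; last exact: cphi.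
  by apply: continuous_comp; [exact: cF|exact/cf/Fgt0].
have mfF : measurable_fun (`]0, +oo[ : set R) (fun x => f (F x) * phi x).
  exact: measurable_fun_gt0.
have mf : measurable_fun (`]0, +oo[ : set R) f by exact: measurable_fun_gt0.
have dFE (x : R) : 0 < x -> (F : R -> R)^`()%classic x = phi x.
  by move=> /dF dFx; rewrite derive1E; exact: derive_val.
have step n : (\int[mu]_(x in `[F (n.+1%:R^-1)%R, +oo[) (f x)%:E =
   \int[mu]_(x in `[(n.+1%:R^-1)%R, +oo[) (f (F x) * phi x)%:E)%E.
  rewrite (@increasing_ge0_integration_by_substitutiony _ F f n.+1%:R^-1).
  - apply: eq_integral => x; rewrite inE/= in_itv/= andbT => nx.
    by rewrite !fctE dFE//; exact: lt_le_trans nx.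
  - move=> x y; rewrite !in_itv/= !andbT => nx ny.
    by apply: Fi; rewrite in_itv/= andbT; exact: lt_le_trans (pos n) _.
  - move=> x; rewrite in_itv/= andbT => nx.
    have x0 : 0 < x by exact: lt_trans nx.
    rewrite /continuous_at dFE//; apply: cvg_trans (cphi _ x0).
    by apply: near_eq_cvg; near=> z; apply/esym/dFE; near: z; exact: lt_nbhsr.
  - apply/cvg_ex; exists (phi n.+1%:R^-1).
    apply: cvg_trans (cvg_at_right_filter (cphi _ (pos n))).
    by apply: near_eq_cvg; near=> z; apply/esym/dFE; rewrite (lt_trans (pos n)).
  - apply/cvg_ex; exists l; apply: cvg_trans phil.
    by apply: near_eq_cvg; near=> z; apply/esym/dFE.
  - split; last exact/cvg_at_right_filter/cF.
    move=> x; rewrite in_itv/= andbT => nx.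
    by apply: ex_derive; apply: dF; exact: lt_trans nx.
  - exact: Fy.
  - apply: continuous_in_subspaceT => x; rewrite inE/= in_itv/= andbT => nx.
    by apply: cf; apply: lt_le_trans nx; exact: Fgt0.
  - move=> x; rewrite in_itv/= andbT => nx.
    by apply: f0; apply: lt_trans nx; exact: Fgt0.
have R1 : (\int[mu]_(x in `[(n.+1%:R^-1)%R,
  +oo[) (f (F x) * phi x)%:E @[n --> \oo] -->
   \int[mu]_(x in `]0%R, +oo[) (f (F x) * phi x)%:E)%E.
  apply: ge0_cvg_integral_itvVy; first exact/measurable_EFinP.
  by move=> x x0; rewrite lee_fin mulr_ge0 ?phi0// f0// Fgt0.
have L1 : (\int[mu]_(x in `[F (n.+1%:R^-1)%R, +oo[) (f x)%:E @[n --> \oo] -->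
   \int[mu]_(x in `]0%R, +oo[) (f x)%:E)%E.
  have -> : `]0, +oo[%classic = \bigcup_n `[F n.+1%:R^-1, +oo[%classic.
    apply/seteqP; split => x /=; last first.
      move=> [n _] /=; rewrite !in_itv/= !andbT; apply: lt_le_trans.
      exact: Fgt0.
    rewrite in_itv/= andbT => x0.
    have /cvgr_lt := cvg_invS_right F0 => /(_ _ x0)[n _ /(_ _ (leqnn n)) Fn].
    by exists n => //=; rewrite in_itv/= andbT ltW.
  have sub n : `[F n.+1%:R^-1, +oo[%classic `<=` (`]0%R, +oo[%classic : set R).
    by move=> x /=; rewrite !in_itv/= !andbT; apply: lt_le_trans; exact: Fgt0.
  apply: ge0_nondecreasing_set_cvg_integral => //.
  + apply/nondecreasing_seqP => n; rewrite subsetEset => x/=.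
    rewrite !in_itv/= !andbT; apply: le_trans; apply/ltW/Fi;
      rewrite ?in_itv/= ?andbT//.
    by rewrite ltf_pV2 ?posrE// ltr_nat.
  + by move=> n; apply/measurable_EFinP; exact: (measurable_funS _ (@sub n)).
  + by move=> n x /sub/=; rewrite in_itv/= andbT lee_fin; exact: f0.
move: L1; rewrite (eq_cvg _ _ step) => L1.
by move/cvg_lim : L1 => <-//; move/cvg_lim : R1 => <-.
Unshelve. all: by end_near. Qed.

End half_line.

(** * Derivative rules, limits and dominating functions *)

Section calculus.
Variable R : realType.
Implicit Types (f g : R -> R).

(** This rule and the next ones use pointwise functions and ring multiplication, so that derivatives
    compose as terms and the resulting values can be handed to [ring] and [field]. *)
Lemma is_derive_mul f g (x a b : R) : is_derive x 1 f a -> is_derive x 1 g b ->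
  is_derive x 1 (fun t => f t * g t) (a * g x + f x * b).
Proof.
move=> df dg; apply: (is_derive_eq (is_deriveM df dg)).
by rewrite -![_ *: _]/(_ * _) addrC [g x * _]mulrC.
Qed.

Lemma is_derive_add f g (x a b : R) : is_derive x 1 f a -> is_derive x 1 g b ->
  is_derive x 1 (fun t => f t + g t) (a + b).
Proof. by move=> df dg; exact: (is_deriveD df dg). Qed.

Lemma is_derive_cstD f (k x a : R) : is_derive x 1 f a ->
  is_derive x 1 (fun t => k + f t) a.
Proof.
move=> df; have H := is_deriveD (is_derive_cst k x 1) df.
exact: (is_derive_eq H (add0r a)).
Qed.

Lemma is_derive_scale f (k x a : R) : is_derive x 1 f a ->
  is_derive x 1 (fun t => k * f t) (k * a).
Proof. by move=> df; exact: (is_deriveZ k df). Qed.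

Lemma is_derive_inv f (x a : R) : f x != 0 -> is_derive x 1 f a ->
  is_derive x 1 (fun t => (f t)^-1) (- (f x ^+ 2)^-1 * a).
Proof. by move=> fx df; exact: (is_deriveV fx df). Qed.

Lemma is_derive_chain f g (x a b : R) : is_derive (g x) 1 f a ->
  is_derive x 1 g b ->
  is_derive x 1 (fun t => f (g t)) (a * b).
Proof. exact: is_derive1_comp. Qed.

Lemma is_derive_cosM (k x : R) :
  is_derive x 1 (fun t => cos (k * t)) (- k * sin (k * x)).
Proof.
apply: (is_derive_eq (is_derive_chain (is_derive_cos (k * x))
  (is_derive_scale k (is_derive_id x 1)))).
by rewrite mulr1 mulrC mulrN mulNr.
Qed.

Lemma is_derive_sinM (k x : R) :
  is_derive x 1 (fun t => sin (k * t)) (k * cos (k * x)).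
Proof.
apply: (is_derive_eq (is_derive_chain (is_derive_sin (k * x))
  (is_derive_scale k (is_derive_id x 1)))).
by rewrite mulr1 mulrC.
Qed.

Lemma continuous_powR (p x : R) : 0 < x -> {for x,
  continuous (fun y : R => y `^ p)}.
Proof. by move=> x0; apply: is_derive_continuous; exact: is_derive1_powR. Qed.

Lemma cvgy_inv : (x^-1 : R) @[x --> +oo] --> (0 : R).
Proof.
apply/(@cvgrVy R R +oo%R _ (fun x : R => x^-1)).
  by near=> x; rewrite invr_gt0; near: x; exact: nbhs_pinfty_gt.
by apply: cvg_trans (@cvg_id _ +oo%R); apply: near_eq_cvg; near=> x => /=;
  rewrite /unstable.inv_fun invrK.
Unshelve. all: by end_near. Qed.

Lemma cvgy_inv_right : (x^-1 : R) @[x --> +oo] --> 0^'+.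
Proof.
have H := cvgy_inv.
move=> A [e/= e0 He]; move/cvgrPdist_lt : H => /(_ _ e0) H.
suff : \forall x \near +oo%R, A x^-1 by [].
near=> x; apply: He => /=; first by near: x.
by rewrite invr_gt0; near: x; exact: nbhs_pinfty_gt.
Unshelve. all: by end_near. Qed.

Lemma continuous_oneDsqr_powR (p x : R) :
  {for x, continuous (fun y : R => (1 + y ^+ 2) `^ p)}.
Proof.
apply: (@continuous_comp _ _ _ (fun y : R => 1 + y ^+ 2) (fun z : R => z `^ p)).
  by apply: continuousD; [exact: cvg_cst|exact: exprn_continuous].
by apply: continuous_powR; rewrite ltr_pwDl// sqr_ge0.
Qed.

Lemma powRN_cvgy (p : R) : 0 < p -> x `^ (- p) @[x --> +oo] --> (0 : R).
Proof.
move=> p0.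
have H := cvg_comp _ _ (cvgy_inv_right) (powR_cvg0 p0).
apply: cvg_trans H; apply: near_eq_cvg; near=> x => /=.
have x0 : 0 <= x by near: x; exact: nbhs_pinfty_ge.
by rewrite -powR_inv1// -powRrM mulN1r.
Unshelve. all: by end_near. Qed.

Lemma dominated_integrable_gt0 f g :
  measurable_fun (`]0, +oo[ : set R) f ->
  (forall x : R, 0 < x -> `|f x| <= g x) ->
  (@lebesgue_measure R).-integrable `]0, +oo[ (EFin \o g) ->
  (@lebesgue_measure R).-integrable `]0, +oo[ (EFin \o f).
Proof.
move=> mf fg; apply: le_integrable => //; first exact/measurable_EFinP.
move=> x /=; rewrite in_itv/= andbT => /fg fgx.
by rewrite lee_fin (le_trans fgx)// ler_norm.
Qed.

Lemma integrable_gt0Z k f :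
  (@lebesgue_measure R).-integrable `]0, +oo[ (EFin \o f) ->
  (@lebesgue_measure R).-integrable `]0, +oo[ (EFin \o (fun x => k * f x)).
Proof. exact: (@integrableZl _ _ R (@lebesgue_measure R) _ (measurable_itv _)
  k). Qed.

Lemma integrable_gt0D f g :
  (@lebesgue_measure R).-integrable `]0, +oo[ (EFin \o f) ->
  (@lebesgue_measure R).-integrable `]0, +oo[ (EFin \o g) ->
  (@lebesgue_measure R).-integrable `]0, +oo[ (EFin \o (fun x => f x + g x)).
Proof. exact: (@integrableD _ _ R (@lebesgue_measure R) _ (measurable_itv _)).
  Qed.

Lemma Rintegral_gt0Z k f :
  (@lebesgue_measure R).-integrable `]0, +oo[ (EFin \o f) ->
  \int[@lebesgue_measure R]_(x in `]0, +oo[) (k * f x) =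
  k * \int[@lebesgue_measure R]_(x in `]0, +oo[) f x.
Proof. by move=> intf; rewrite RintegralZl. Qed.

Lemma Rintegral_gt0D f g :
  (@lebesgue_measure R).-integrable `]0, +oo[ (EFin \o f) ->
  (@lebesgue_measure R).-integrable `]0, +oo[ (EFin \o g) ->
  \int[@lebesgue_measure R]_(x in `]0, +oo[) (f x + g x) =
  \int[@lebesgue_measure R]_(x in `]0, +oo[) f x +
  \int[@lebesgue_measure R]_(x in `]0, +oo[) g x.
Proof. by move=> intf intg; rewrite RintegralD. Qed.

(* An antiderivative is [(x / (1 + x)) ^ p / p]. *)
Lemma integrable_beta_prime (p : R) : 0 < p ->
  (@lebesgue_measure R).-integrable `]0, +oo[
    (EFin \o (fun x => x `^ (p - 1) * (1 + x) `^ (- (p + 1)))).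
Proof.
move=> p0.
have c1 (x : R) : 0 < x -> 0 < 1 + x by move=> x0; rewrite addr_gt0.
have dF (x : R) : 0 < x -> is_derive x 1 (fun x => p^-1 * (x / (1 + x)) `^ p)
   (x `^ (p - 1) * (1 + x) `^ (- (p + 1))).
  move=> x0; have x1 := c1 _ x0.
  have d1 := is_derive_cstD 1 (is_derive_id x 1).
  have d2 := is_derive_mul (is_derive_id x 1) (is_derive_inv (lt0r_neq0 x1) d1).
  have d3 := @is_derive_chain (fun y => y `^ p)
    (fun x => x / (1 + x)) x _ _ (is_derive1_powR p (divr_gt0 x0 x1)) d2.
  apply: (is_derive_eq (is_derive_scale p^-1 d3)).
  have x1n : 1 + x != 0 by rewrite gt_eqF.
  have -> : (x / (1 + x)) `^ (p - 1) = x `^ (p - 1) * (1 + x) `^ (-1 * (p - 1)).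
    by rewrite powRM ?invr_ge0 ?(ltW x0) ?(ltW x1)// powRrM powR_inv1// ltW.
  have -> : - (p + 1) = -1 * (p - 1) + - 2%:R by ring.
  rewrite [X in _ = _ * X]powRD ?x1n ?implybT// powR_invn ?(ltW x1)//.
  set u := _ `^ _; set v := _ `^ _; field.
  by rewrite x1n gt_eqF.
have cf (x : R) : 0 < x -> {for x,
  continuous (fun x => x `^ (p - 1) * (1 + x) `^ (- (p + 1)))}.
  move=> x0; apply: continuousM; first exact: continuous_powR.
  apply: (@continuous_comp _ _ _ (fun x : R => 1 + x)
    (fun y => y `^ (- (p + 1)))).
    by apply: is_derive_continuous;
      exact: (is_derive_cstD 1 (is_derive_id x 1)).
  by apply: continuous_powR; exact: c1.
apply/integrableP; split; first by apply/measurable_EFinP;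
  exact: measurable_fun_gt0.
under eq_integral.
  move=> x; rewrite inE/= in_itv/= andbT => x0.
  rewrite ger0_norm; last by rewrite mulr_ge0 ?powR_ge0.
  over.
rewrite /= (ge0_FTC0y _ cf dF (A := 0) (B := p^-1)) ?ltry//.
- by move=> x x0; rewrite mulr_ge0 ?powR_ge0.
- rewrite -[X in _ --> X](mulr0 p^-1); apply: cvgM; first exact: cvg_cst.
  apply: (@squeeze_cvgr _ _ _ _ (cst 0) (fun x => x `^ p)); last 2 first.
  + exact: cvg_cst.
  + exact: powR_cvg0.
  near=> x; have x0 : 0 < x by [].
  rewrite powR_ge0/= ge0_ler_powR ?(ltW p0) ?nnegrE ?divr_ge0 ?(ltW x0) ?(ltW
    (c1 _ x0))//.
  by rewrite ler_pdivrMr ?c1// ler_peMr ?(ltW x0)// lerDl ltW.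
- rewrite -[X in _ --> X](mulr1 p^-1); apply: cvgM; first exact: cvg_cst.
  have L : x / (1 + x) @[x --> +oo] --> (1 : R).
    have : 1 - (1 + x)^-1 @[x --> +oo] --> (1 - 0 : R).
      apply: cvgB; first exact: cvg_cst.
      apply: (@squeeze_cvgr _ _ _ _ (cst 0) (fun x => x^-1)); last 2 first.
      - exact: cvg_cst.
      - exact: cvgy_inv.
      near=> x; have x0 : 0 < x by near: x; exact: nbhs_pinfty_gt.
      by rewrite /= invr_ge0 (ltW (c1 _ x0))/= lef_pV2 ?posrE ?c1// lerDr ler01.
    rewrite subr0; apply: cvg_trans; apply: near_eq_cvg; near=> x.
    have x0 : 0 < x by near: x; exact: nbhs_pinfty_gt.
    by field; rewrite gt_eqF ?c1.
  have := @cvg_comp _ _ _ (fun x : R => x / (1 + x))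
    (fun y => y `^ p) +oo%R _ _ L (continuous_powR (p := p) (@ltr01 R)).
  by rewrite powR1.
Unshelve. all: by end_near. Qed.

(** With an integer [n + 1 >= p], [e ^ (1 + t)] is at least [(1 + t) ^ (n + 1) / (n + 1)!]; the
    factor [e] in the constant accounts for the shift from [t] to [1 + t]. *)
Lemma expRN_le_powR (p : R) : 0 < p ->
  exists2 C : R, 0 < C & forall t : R,
    0 < t -> expR (- t) <= C * (1 + t) `^ (- p).
Proof.
move=> p0; pose n := Num.bound p; exists (n.+1`!%:R * expR 1).
  by rewrite mulr_gt0 ?expR_gt0// ltr0n fact_gt0.
move=> t t0; have t1 : 0 < 1 + t by rewrite addr_gt0.
rewrite powRN ler_pdivlMr ?powR_gt0// mulrC -ler_pdivlMr ?expR_gt0// expRN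
  invrK.
rewrite -mulrA -expRD.
have h : (1 + t) `^ p <= (1 + t) ^+ n.+1.
  rewrite -powR_mulrn ?(ltW t1)// ler_powR ?lerDl ?(ltW t0)//.
  by rewrite (le_trans (ltW (archi_boundP (ltW p0))))// ler_nat.
apply: (le_trans h); rewrite mulrC -ler_pdivrMr ?ltr0n ?fact_gt0//.
by apply: le_trans (expR_ge1Dxn n (ltW t1)); rewrite lerDr.
Qed.

Definition Gamma_weight (s t : R) : R := t `^ (s - 1) * expR (- t).

Lemma Gamma_weight_ge0 s t : 0 <= Gamma_weight s t.
Proof. by rewrite mulr_ge0 ?powR_ge0 ?expR_ge0. Qed.

Lemma continuous_Gamma_weight s t : 0 < t -> {for t,
  continuous (Gamma_weight s)}.
Proof.
move=> t0; apply: continuousM; first exact: continuous_powR.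
apply: (@continuous_comp _ _ _ (fun x : R => - x) expR);
  last exact: continuous_expR.
exact: opp_continuous.
Qed.

(** Replacing [e ^ (- t)] by a multiple of [(1 + t) ^ (- (s + 1))] gives a dominating function with
    an explicit antiderivative, which handles 0 and infinity at once. *)
Lemma integrable_Gamma_weight (s : R) : 0 < s ->
  (@lebesgue_measure R).-integrable `]0, +oo[ (EFin \o Gamma_weight s).
Proof.
move=> s0; have [|C C0 HC] := @expRN_le_powR (s + 1); first by rewrite addr_gt0.
apply: (@dominated_integrable_gt0 _
   (fun t => C * (t `^ (s - 1) * (1 + t) `^ (- (s + 1))))).
- by apply: measurable_fun_gt0 => x; exact: continuous_Gamma_weight.
- move=> t t0; rewrite ger0_norm ?Gamma_weight_ge0// mulrCA.
  by rewrite ler_wpM2l ?powR_ge0// HC.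
- exact: integrable_gt0Z (integrable_beta_prime s0).
Qed.

(** Differentiating a transform brings down a factor [t]; the family of Gamma weights absorbs it. *)
Lemma Gamma_weight_shift (s t : R) : 0 < t ->
  t * Gamma_weight s t = Gamma_weight (s + 1) t.
Proof.
move=> t0; rewrite /Gamma_weight addrK mulrA; congr (_ * _).
rewrite -[in RHS](subrK 1 s) [RHS]powRD ?(gt_eqF t0) ?implybT//.
by rewrite powRr1 ?(ltW t0)// mulrC.
Qed.

Lemma cvg_Gamma_weight0 (s : R) : 0 < s ->
  Gamma_weight (s + 1) t @[t --> 0^'+] --> (0 : R).
Proof.
move=> s0; rewrite -[X in _ --> X](mul0r (expR (- 0))); apply: cvgM.
  by rewrite addrK; exact: powR_cvg0.
apply: cvg_at_right_filter;
  apply: (@continuous_comp _ _ _ (fun x : R => - x) expR);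
  last exact: continuous_expR.
exact: opp_continuous.
Qed.

Lemma cvg_Gamma_weighty (s : R) : 0 < s ->
  Gamma_weight (s + 1) t @[t --> +oo] --> (0 : R).
Proof.
move=> s0; have [|C C0 HC] := @expRN_le_powR (s + 1); first by rewrite addr_gt0.
apply: (@squeeze_cvgr _ _ _ _ (cst 0) (fun x => C * x^-1)); last 2 first.
- exact: cvg_cst.
- by rewrite -[X in _ --> X](mulr0 C); apply: cvgM;
  [exact: cvg_cst|exact: cvgy_inv].
near=> t; have t0 : 0 < t by near: t; exact: nbhs_pinfty_gt.
rewrite /= Gamma_weight_ge0/= /Gamma_weight addrK.
apply: (le_trans (ler_wpM2l (powR_ge0 _ _) (HC _ t0))).
rewrite mulrCA ler_wpM2l ?(ltW C0)//.
have -> : t^-1 = t `^ s * t `^ (- (s + 1)).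
  by rewrite -powRD ?(gt_eqF t0) ?implybT// opprD addrA subrr sub0r powR_inv1//
    ltW.
rewrite ler_wpM2l ?powR_ge0// !powRN lef_pV2 ?posrE ?powR_gt0 ?addr_gt0//.
by rewrite ge0_ler_powR ?nnegrE ?addr_ge0 ?(ltW s0) ?(ltW t0)// lerDr.
Unshelve. all: by end_near. Qed.

Lemma GammaE s : Gamma s = \int[@lebesgue_measure R]_(t in `]0,
  +oo[) Gamma_weight s t.
Proof. by []. Qed.

(** The common majorant of all the singular kernels below. Integrability at 0 uses [a < 2], at
    infinity [0 < a]. *)
Lemma integrable_min_powR (a : R) : 0 < a < 2 ->
  (@lebesgue_measure R).-integrable `]0, +oo[
    (EFin \o (fun y => Num.min 1 (y ^+ 2) * y `^ (- (1 + a)))).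
Proof.
move=> /andP[a0 a2].
(* [h] controls the region [y > 1]; it has the antiderivative [- (1 + y ^ 2) ^ (- a / 2) / a]. *)
pose h (y : R) := y * (1 + y ^+ 2) `^ (- (a / 2 + 1)).
have c1 (y : R) : 0 < 1 + y ^+ 2 by rewrite ltr_pwDl// sqr_ge0.
have dF (y : R) : 0 < y -> is_derive y 1 (fun y => - a^-1 * (1 + y ^+ 2) `^ (-
  (a / 2))) (h y).
  move=> y0.
  have d1 := is_derive_cstD 1 (is_derive_mul (is_derive_id y 1)
    (is_derive_id y 1)).
  have d2 := @is_derive_chain (fun z => z `^ (- (a / 2)))
    (fun y => 1 + y * y) y _ _ (is_derive1_powR _ (c1 y)) d1.
  apply: (is_derive_eq (is_derive_scale (- a^-1) d2)); rewrite /h /=.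
  have -> : - (a / 2) - 1 = - (a / 2 + 1) by ring.
  by set u := _ `^ _; field; rewrite gt_eqF.
have ch (y : R) : {for y, continuous h}.
  apply: continuousM; first exact: cvg_id.
  exact: continuous_oneDsqr_powR.
have h0 (y : R) : 0 < y -> 0 <= h y by move=> y0;
  rewrite mulr_ge0 ?powR_ge0 ?ltW.
have ih : (@lebesgue_measure R).-integrable `]0, +oo[ (EFin \o h).
  apply/integrableP; split; first by apply/measurable_EFinP;
    apply: measurable_fun_gt0.
  under eq_integral.
    move=> x; rewrite inE/= in_itv/= andbT => x0.
    rewrite ger0_norm ?h0//.
    over.
  rewrite /= (ge0_FTC0y h0 _ dF (A := - a^-1 * 1) (B := - a^-1 * 0)) ?ltry//.
  - apply: cvgM; first exact: cvg_cst.
    have := cvg_at_right_filter (@continuous_oneDsqr_powR (- (a / 2)) 0).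
    by rewrite expr0n addr0 powR1.
  - apply: cvgM; first exact: cvg_cst.
    apply: (@cvg_comp _ _ _ (fun y : R => 1 + y ^+ 2)
      (fun z => z `^ (- (a / 2))) +oo%R +oo%R); last first.
      by apply: powRN_cvgy; rewrite divr_gt0.
    apply: (@ger_cvgy _ _ _ _ (fun y => y ^+ 2)).
      by near=> y; rewrite lerDr.
    exact: cvgr_expr2.
have G := integrable_Gamma_weight (s := 2 - a).
(* For [y <= 1], [e ^ (1 - y) >= 1] and [y ^ 2 * y ^ (- (1 + a))] is the power in the Gamma weight.
   For [y > 1], [1 + y ^ 2 <= 2 * y ^ 2], whence the factor [2 ^ (a / 2 + 1)]. *)
have bnd (y : R) : 0 < y -> `|Num.min 1 (y ^+ 2) * y `^ (- (1 + a))| <=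
    expR 1 * Gamma_weight (2 - a) y + 2 `^ (a / 2 + 1) * h y.
  move=> y0; rewrite ger0_norm ?mulr_ge0 ?powR_ge0 ?le_min ?ler01 ?sqr_ge0//.
  have [y1|y1] := lerP y 1.
    rewrite (@le_trans _ _ (expR 1 * Gamma_weight (2 - a) y))//; last first.
      by rewrite lerDl mulr_ge0 ?powR_ge0 ?h0.
    rewrite min_r; last by rewrite expr_le1// ltW.
    rewrite /Gamma_weight mulrCA -expRD -powR_mulrn ?(ltW y0)// -powRD ?(gt_eqF
      y0) ?implybT//.
    have -> : 2%:R + - (1 + a) = 2 - a - 1 :> R by ring.
    rewrite ler_peMr ?powR_ge0//.
    by rewrite -[leLHS]expR0 ler_expR subr_ge0.
  rewrite (@le_trans _ _ (2 `^ (a / 2 + 1) * h y))//; last first.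
    by rewrite lerDr mulr_ge0 ?Gamma_weight_ge0 ?expR_ge0.
  rewrite min_l; last by rewrite expr_ge1 ?(ltW y0)// ltW.
  rewrite mul1r /h.
  have -> : y `^ (- (1 + a)) = y * y `^ (- (a + 2)).
    rewrite -{2}[y]powRr1 ?(ltW y0)// -powRD ?(gt_eqF y0) ?implybT//.
    by congr (_ `^ _); ring.
  rewrite [leRHS]mulrCA ler_wpM2l ?(ltW y0)// [in leRHS]powRN ler_pdivlMr
    ?powR_gt0//.
  rewrite powRN mulrC ler_pdivrMr ?powR_gt0//.
  have -> : a + 2 = 2%:R * (a / 2 + 1) by field.
  rewrite powRrM powR_mulrn ?(ltW y0)// -powRM ?sqr_ge0//.
  rewrite ge0_ler_powR ?nnegrE ?addr_ge0 ?mulr_ge0 ?sqr_ge0 ?divr_ge0 ?(ltW a0)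
    ?(ltW y0)//.
  by rewrite mulr_natl mulr2n lerD2r expr_ge1 ?(ltW y0)// ltW.
apply: (dominated_integrable_gt0 _ bnd).
  apply: measurable_funM.
    exact: measurable_minr.
  exact: measurable_funTS (measurable_powR _).
apply: integrable_gt0D; last exact: integrable_gt0Z.
by apply/integrable_gt0Z/G; rewrite subr_gt0.
Unshelve. all: by end_near. Qed.

End calculus.

(** * One-sided Fourier integrals *)

Section wave.
Variable R : realType.
Local Notation mu := (@lebesgue_measure R).
Local Notation Rpos := (`]0%R, +oo[%classic : set R).
Implicit Types (w W : R -> R).

(* Treating [cos] and [sin] together: the family is closed under [d/du], which
   maps [(a, b)] to [(b, - a)]. *)
Definition wave (a b u : R) : R := a * cos u + b * sin u.

Lemma is_derive_waveM (a b k x : R) :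
  is_derive x 1 (fun t => wave a b (k * t)) (k * wave b (- a) (k * x)).
Proof.
have d := is_derive_add (is_derive_scale a (is_derive_cosM k x))
  (is_derive_scale b (is_derive_sinM k x)).
by apply: (is_derive_eq d); rewrite /wave; ring.
Qed.

Lemma is_derive_wave_mulr (a b k x : R) :
  is_derive x 1 (fun t => wave a b (t * k)) (k * wave b (- a) (x * k)).
Proof.
have -> : (fun t => wave a b (t * k)) = (fun t => wave a b (k * t)).
  by apply/funext => t; rewrite mulrC.
by rewrite [x * k]mulrC; exact: is_derive_waveM.
Qed.

Lemma continuous_wave_mulr (a b k x : R) : {for x,
  continuous (fun t : R => wave a b (t * k))}.
Proof. by apply: is_derive_continuous; exact: is_derive_wave_mulr. Qed.

Lemma norm_wave_le (a b u : R) : `|wave a b u| <= `|a| + `|b|.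
Proof.
rewrite (le_trans (ler_normD _ _))// !normrM lerD// ler_piMr//.
  exact: cos_max.
exact: sin_max.
Qed.

(** The parts odd in [v] cancel: every wave is an eigenfunction of the second difference, with an
    eigenvalue independent of [a] and [b]. This is what makes the operator a Fourier multiplier. *)
Lemma wave_second_difference (a b u v : R) :
  2 * wave a b u - wave a b (u + v) - wave a b (u - v) =
  2 * wave a b u * (1 - cos v).
Proof. by rewrite /wave cosD cosB sinD sinB; ring. Qed.

(** The choices [(1, 0)] and [(0, -1)] of [(a, b)] give the real and imaginary parts of the integral
    of [w t * e ^ (- i t x)] over the half-line. *)
Definition wave_transform w (a b x : R) : R :=
  \int[mu]_(t in Rpos) (w t * wave a b (t * x)).

Lemma integrable_waveM w (a b x : R) : mu.-integrable Rpos (EFin \o w) ->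
  mu.-integrable Rpos (EFin \o (fun t => w t * wave a b (t * x))).
Proof.
move=> iw; have mw : measurable_fun Rpos w.
  by apply/measurable_EFinP; exact: measurable_int iw.
apply: (@dominated_integrable_gt0 _ _ (fun t => (`|a| + `|b|) * `|w t|)).
- apply: measurable_funM => //.
  apply: measurable_fun_gt0 => t _.
  exact: continuous_wave_mulr.
- by move=> t _; rewrite normrM mulrC ler_wpM2r// norm_wave_le.
- by apply: integrable_gt0Z; exact: integrable_abse iw.
Qed.

Lemma wave_transform_linear w (a b x : R) : mu.-integrable Rpos (EFin \o w) ->
  wave_transform w a b x = a * wave_transform w 1 0 x + b * wave_transform w 0
    1 x.
Proof.
move=> iw; rewrite /wave_transform -!RintegralZl//; try exact: integrable_waveM.
rewrite -RintegralD//; try by apply: integrable_gt0Z; exact: integrable_waveM.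
by apply: eq_Rintegral => t _; rewrite /wave; ring.
Qed.

Lemma is_derive_wave_transform w (a b x : R) :
  mu.-integrable Rpos (EFin \o w) ->
  mu.-integrable Rpos (EFin \o (fun t => t * w t)) ->
  is_derive x 1 (wave_transform w a b)
    (wave_transform (fun t => t * w t) b (- a) x).
Proof.
move=> iw itw.
pose f (x t : R) := w t * wave a b (t * x).
have df (y t : R) : is_derive y 1 (f ^~ t) (t * w t * wave b (- a) (t * y)).
  apply: (is_derive_eq (is_derive_scale (w t) (is_derive_waveM a b t y))).
  by rewrite mulrCA mulrA.
(* Any neighbourhood of [x] would serve: the bound [G] below does not depend on the point. *)
have Ix : `]x - 1, x + 1[%classic x.
  by rewrite /= in_itv/= ltrBlDr ltrDl ltr01.
have intf (y : R) : `]x - 1,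
  x + 1[%classic y -> mu.-integrable Rpos (EFin \o f y).
  by move=> _; exact: integrable_waveM.
have derf (y t : R) : `]x - 1,
  x + 1[%classic y -> Rpos t -> derivable (f ^~ t) y 1.
  by move=> _ _; apply: ex_derive; exact: df.
pose G t := (`|b| + `|- a|) * `|t * w t|.
have G0 t : 0 <= G t by rewrite mulr_ge0 ?addr_ge0.
have iG : mu.-integrable Rpos (EFin \o G).
  by apply: integrable_gt0Z; exact: integrable_abse itw.
have Gub (y t : R) : `]x - 1,
  x + 1[%classic y -> Rpos t -> `|partial1of2 f y t| <= G t.
  move=> _ _; rewrite partial1of2E (derive_val (is_derive :=
    df y t)) /G normrM mulrC.
  by rewrite ler_wpM2r// norm_wave_le.
apply: DeriveDef.
  exact: (derivable_under_integral (mu := mu) (f :=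
    f) (measurable_itv _) Ix intf derf G0 iG Gub).
rewrite -derive1E (differentiation_under_integral (mu := mu) (f :=
  f) (measurable_itv _) Ix intf derf G0 iG Gub).
apply: eq_Rintegral => t _.
by rewrite partial1of2E (derive_val (is_derive := df x t)).
Qed.

(** The derivative of [W t * wave a b (t * x)] is integrated. Its limit at 0 is [A * a] because
    [wave a b 0 = a], and at infinity the decay of [W] beats the bounded wave. *)
Lemma integration_by_parts_wave (W dW : R -> R) (A a b x : R) :
  mu.-integrable Rpos (EFin \o W) -> mu.-integrable Rpos (EFin \o dW) ->
  (forall t : R, 0 < t -> is_derive t 1 W (dW t)) ->
  (forall t : R, 0 < t -> {for t, continuous dW}) ->
  W t @[t --> 0^'+] --> A -> W t @[t --> +oo] --> 0 ->
  wave_transform dW a b x + x * wave_transform W b (- a) x = - (A * a).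
Proof.
move=> iW idW dWE cdW W0 Wy.
have iW1 := integrable_gt0Z x (integrable_waveM b (- a) x iW).
have idW1 := integrable_waveM a b x idW.
rewrite /wave_transform -RintegralZl//; last exact: integrable_waveM.
rewrite -RintegralD//.
rewrite -[RHS]sub0r; apply: (@FTC0y _ _ (fun t => W t * wave a b (t * x))
  (A * a) 0).
- exact: integrable_gt0D.
- move=> t t0.
  apply: continuousD; first by apply: continuousM;
    [exact: cdW|exact: continuous_wave_mulr].
  apply: continuousM; first exact: cst_continuous.
  apply: continuousM; last exact: continuous_wave_mulr.
  by apply: is_derive_continuous; exact: dWE.
- move=> t t0.
  apply: (is_derive_eq (is_derive_mul (dWE t t0)
    (is_derive_wave_mulr a b x t))).
  by rewrite mulrCA.
- have -> : A * a = A * wave a b (0 * x) by rewrite /wave mul0r cos0 sin0 mulr0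
  addr0 mulr1.
  by apply: cvgM => //; apply: cvg_at_right_filter; exact: continuous_wave_mulr.
- apply/norm_cvg0P.
  apply: (@squeeze_cvgr _ _ _ _ (cst 0) (fun t => (`|a| + `|b|) * `|W t|));
    last 2 first.
  + exact: cvg_cst.
  + rewrite -[X in _ --> X](mulr0 (`|a| + `|b|)); apply: cvgM;
    first exact: cvg_cst.
    exact/norm_cvg0P.
  near=> t; rewrite /= normr_ge0/= normrM mulrC.
  by rewrite ler_wpM2r// norm_wave_le.
Unshelve. all: by end_near. Qed.

(** Integration by parts, the weight at [s + 1] having derivative [s] times the weight at [s] minus
    itself. With [T s] the complex transform, this is the real form of
    [s * T s = (1 + i x) * T (s + 1)]. *)
Lemma wave_transform_Gamma_rec (s a b x : R) : 0 < s ->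
  s * wave_transform (Gamma_weight s) a b x =
  wave_transform (Gamma_weight (s + 1)) a b x -
  x * wave_transform (Gamma_weight (s + 1)) b (- a) x.
Proof.
move=> s0; have s1 : 0 < s + 1 by rewrite addr_gt0.
have i0 := integrable_Gamma_weight s0; have i1 := integrable_Gamma_weight s1.
pose dW t := s * Gamma_weight s t + -1 * Gamma_weight (s + 1) t.
have idW : mu.-integrable Rpos (EFin \o dW).
  by apply: integrable_gt0D; exact: integrable_gt0Z.
have dWE (t : R) : 0 < t -> is_derive t 1 (Gamma_weight (s + 1)) (dW t).
  move=> t0; have de := @is_derive_chain _ expR -%R t _ _ (is_derive_expR _)
    (is_deriveN (is_derive_id t 1)).
  apply: (is_derive_eq (is_derive_mul (is_derive1_powR (s + 1 - 1) t0) de)).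
  by rewrite /dW /Gamma_weight addrK; ring.
have cdW (t : R) : 0 < t -> {for t, continuous dW}.
  move=> t0; apply: continuousD; apply: continuousM; try exact: cst_continuous;
    exact: continuous_Gamma_weight.
have := integration_by_parts_wave a b x i1 idW dWE cdW (cvg_Gamma_weight0 s0)
  (cvg_Gamma_weighty s0).
rewrite mul0r oppr0.
have -> : wave_transform dW a b x = s * wave_transform (Gamma_weight s) a b x -
  wave_transform (Gamma_weight (s + 1)) a b x.
  rewrite /wave_transform -RintegralZl//; last exact: integrable_waveM.
  rewrite -RintegralB//; [|by apply: integrable_gt0Z;
    exact: integrable_waveM|exact: integrable_waveM].
  by apply: eq_Rintegral => t _; rewrite /dW; ring.
by move=> h; rewrite -[LHS]subr0 -h; ring.
Qed.

Lemma is_derive_wave_transform_Gamma (s a b x : R) : 0 < s ->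
  is_derive x 1 (wave_transform (Gamma_weight s) a b)
    (wave_transform (Gamma_weight (s + 1)) b (- a) x).
Proof.
move=> s0; have s1 : 0 < s + 1 by rewrite addr_gt0.
have E t : Rpos t -> t * Gamma_weight s t = Gamma_weight (s + 1) t.
  by rewrite /= in_itv/= andbT; exact: Gamma_weight_shift.
have -> : wave_transform (Gamma_weight (s + 1)) b (- a) x =
          wave_transform (fun t => t * Gamma_weight s t) b (- a) x.
  by apply: eq_Rintegral => t; rewrite inE => /E ->.
apply: is_derive_wave_transform; first exact: integrable_Gamma_weight.
apply: eq_integrable (integrable_Gamma_weight s1) => //.
by move=> t; rewrite inE => /E /= ->.
Qed.

Lemma wave_transform_Gamma0 (s a b : R) : 0 < s ->
  wave_transform (Gamma_weight s) a b 0 = a * Gamma s.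
Proof.
move=> s0; rewrite GammaE -RintegralZl//; last exact: integrable_Gamma_weight.
by apply: eq_Rintegral => t _; rewrite /wave mulr0 cos0 sin0; ring.
Qed.

(** The recurrence above at [x = 0]. *)
Lemma GammaS (s : R) : 0 < s -> Gamma (s + 1) = s * Gamma s.
Proof.
move=> s0; have := wave_transform_Gamma_rec 1 0 0 s0.
by rewrite !wave_transform_Gamma0 ?addr_gt0// !mul1r mul0r subr0.
Qed.

(** The recurrence and the derivative rule together give the equation [(1 + i x) T' = - i s T] for
    the complex transform [T], and [T 0 = Gamma s]; hence [T = Gamma s * (1 + i x) ^ (- s)], stated
    in polar form. *)
Lemma wave_transform_Gamma (s a b x : R) : 0 < s ->
  wave_transform (Gamma_weight s) a b x =
  Gamma s * (1 + x ^+ 2) `^ (- (s / 2)) * wave a b (s * atan x).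
Proof.
move=> s0; have s1 : 0 < s + 1 by rewrite addr_gt0.
pose c := wave_transform (Gamma_weight s) 1 0.
pose d := wave_transform (Gamma_weight s) 0 1.
have x1 (y : R) : 0 < 1 + y ^+ 2 by rewrite ltr_pwDl// sqr_ge0.
pose r (y : R) := (1 + y ^+ 2) `^ (s / 2).
(* [M y - i N y = (1 + i y) ^ s * (c y - i d y)] has zero derivative. *)
pose M y := r y * (c y * cos (s * atan y) + d y * sin (s * atan y)).
pose N y := r y * (d y * cos (s * atan y) + c y * (-1 * sin (s * atan y))).
have dr (y : R) : is_derive y 1 r (s * y * (1 + y ^+ 2) `^ (s / 2 - 1)).
  have d1 := is_derive_cstD 1 (is_derive_mul (is_derive_id y 1)
    (is_derive_id y 1)).
  have d2 := @is_derive_chain _ (fun z => z `^ (s / 2))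
    (fun y => 1 + y * y) y _ _ (is_derive1_powR _ (x1 y)) d1.
  by apply: (is_derive_eq d2) => /=; set u := _ `^ _; field.
(* Lets [r] and its derivative share the factor [(1 + y ^ 2) ^ (s / 2 - 1)]. *)
have rE (y : R) : r y = (1 + y ^+ 2) * (1 + y ^+ 2) `^ (s / 2 - 1).
  by rewrite mulr_powRB1 ?(ltW (x1 y))// divr_gt0.
have dcos (y : R) : is_derive y 1 (fun y => cos (s * atan y))
  (- sin (s * atan y) * (s * (1 + y ^+ 2)^-1)).
  exact: (@is_derive_chain _ cos (fun y => s * atan y) y _ _ (is_derive_cos _)
    (is_derive_scale s (is_derive1_atan y))).
have dsin (y : R) : is_derive y 1 (fun y => sin (s * atan y))
  (cos (s * atan y) * (s * (1 + y ^+ 2)^-1)).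
  exact: (@is_derive_chain _ sin (fun y => s * atan y) y _ _ (is_derive_sin _)
    (is_derive_scale s (is_derive1_atan y))).
have dc y := is_derive_wave_transform_Gamma 1 0 y s0.
have dd y := is_derive_wave_transform_Gamma 0 1 y s0.
have i1 := integrable_Gamma_weight s1.
have rc y := wave_transform_Gamma_rec 1 0 y s0.
have rd y := wave_transform_Gamma_rec 0 1 y s0.
have dM (y : R) : is_derive y 1 M 0.
  apply: (is_derive_eq (is_derive_mul (dr y)
    (is_derive_add (is_derive_mul (dc y) (dcos y)) (is_derive_mul (dd y)
    (dsin y))))).
  have hd := rd y; have hc := rc y; move: hc hd.
  rewrite !(wave_transform_linear 0 (- _) _ i1) !(wave_transform_linear 1 (- _)
    _ i1).
  rewrite -/(c y) -/(d y) rE.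
  set C := wave_transform _ _ _ _; set S := wave_transform _ _ _ _.
  set u := _ `^ _; set cs := cos _; set sn := sin _ => hc hd.
  (* The grouping makes [c] and [d] occur only as [s * c y] and [s * d y], the left-hand sides of
     the recurrence. *)
  transitivity (u * (y * (s * c y) * cs + y * (s * d y) * sn +
     (1 + y ^+ 2) * (- S * cs + C * sn) - (s * c y) * sn + (s * d y) * cs)).
    by field; rewrite gt_eqF.
  by rewrite hc hd; ring.
have dN (y : R) : is_derive y 1 N 0.
  apply: (is_derive_eq (is_derive_mul (dr y)
    (is_derive_add (is_derive_mul (dd y) (dcos y)) (is_derive_mul (dc y)
    (is_derive_scale (-1) (dsin y)))))).
  have hd := rd y; have hc := rc y; move: hc hd.
  rewrite !(wave_transform_linear 0 (- _) _ i1) !(wave_transform_linear 1 (- _)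
    _ i1).
  rewrite -/(c y) -/(d y) rE.
  set C := wave_transform _ _ _ _; set S := wave_transform _ _ _ _.
  set u := _ `^ _; set cs := cos _; set sn := sin _ => hc hd.
  transitivity (u * (y * (s * d y) * cs - y * (s * c y) * sn +
     (1 + y ^+ 2) * (C * cs + S * sn) - (s * d y) * sn - (s * c y) * cs)).
    by field; rewrite gt_eqF.
  by rewrite hc hd; ring.
have ME : M x = Gamma s.
  rewrite (is_derive_0_is_cst x 0 dM) /M /r /c /d !wave_transform_Gamma0//.
  by rewrite atan0 mulr0 cos0 sin0 expr0n addr0 powR1; ring.
have NE : N x = 0.
  rewrite (is_derive_0_is_cst x 0 dN) /N /r /c /d !wave_transform_Gamma0//.
  by rewrite atan0 mulr0 sin0; ring.
have rV : r x * (1 + x ^+ 2) `^ (- (s / 2)) = 1.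
  by rewrite powRN mulfV// gt_eqF// powR_gt0.
rewrite wave_transform_linear ?integrable_Gamma_weight// -/(c x) -/(d x).
have cs2 := cos2Dsin2 (s * atan x).
set v := (1 + x ^+ 2) `^ _ in rV *; set C := cos _ in cs2 *;
  set S := sin _ in cs2 *.
(* Undoing the rotation from [(c, d)] to [(M, N)] takes both components; this zero term supplies the
   missing one, and the total carries the factor [C ^ 2 + S ^ 2]. *)
have NE0 : N x * (v * (b * C - a * S)) = 0 by rewrite NE mul0r.
rewrite -[RHS]addr0 -NE0 -ME /M /N /wave -/C -/S.
transitivity ((a * c x + b * d x) * (r x * v) * (C ^+ 2 + S ^+ 2));
  last by ring.
by rewrite rV cs2 !mulr1.
Qed.

(** Differentiation gives [Q' = - S] and integration by parts gives [2 S = y Q], so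
    [Q y * e ^ (y ^ 2 / 4)] is constant, equal to the half-line Gaussian integral. *)
Lemma wave_transform_gauss (x : R) :
  wave_transform (@gauss_fun R) 1 0 x = Num.sqrt pi / 2 * expR (- (x ^+ 2 / 4)).
Proof.
have iW : mu.-integrable Rpos (EFin \o @gauss_fun R).
  exact: integrableS (@integrableT_gauss R).
have cW (t : R) : {for t, continuous (fun t : R => t * gauss_fun t)}.
  by apply: continuousM; [exact: cvg_id|exact: continuous_gauss_fun].
have itW : mu.-integrable Rpos (EFin \o (fun t => t * gauss_fun t)).
  (* [e ^ (- t ^ 2) <= e * e ^ (- t)] because [t - t ^ 2 <= 1 / 4]. *)
  apply: (@dominated_integrable_gt0 _ _ (fun t => expR 1 * Gamma_weight 2 t)).
  - by apply: measurable_fun_gt0 => t _; exact: cW.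
  - move=> t t0; rewrite ger0_norm ?mulr_ge0 ?expR_ge0 ?(ltW t0)//.
    have -> : Gamma_weight 2 t = t * expR (- t).
      rewrite /Gamma_weight; have -> : 2 - 1 = 1 :> R by ring.
      by rewrite powRr1// ltW.
    rewrite mulrCA ler_wpM2l ?(ltW t0)// -expRD ler_expR.
    by have := sqr_ge0 (t - 1 / 2); rewrite expr2 mulrBl !mulrBr; nra.
  - exact/integrable_gt0Z/integrable_Gamma_weight.
have dW (t : R) : is_derive t 1 (@gauss_fun R) (-2 * (t * gauss_fun t)).
  have d := is_deriveN (is_derive_mul (is_derive_id t 1) (is_derive_id t 1)).
  apply: (is_derive_eq (@is_derive_chain _ expR (fun t => - (t * t)) t _ _
    (is_derive_expR _) d)).
  by rewrite /gauss_fun expr2; ring.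
pose Q := wave_transform (@gauss_fun R) 1 0.
pose S := wave_transform (fun t => t * gauss_fun t) 0 1.
have dQ (y : R) : is_derive y 1 Q (- S y).
  have := is_derive_wave_transform 1 0 y iW itW.
  by rewrite (wave_transform_linear _ _ _ itW) mul0r add0r mulN1r.
have ibp (y : R) : 2 * S y = y * Q y.
  have g0 : gauss_fun t @[t --> 0^'+] --> (1 : R).
    have := cvg_at_right_filter (@continuous_gauss_fun R 0).
    by rewrite /gauss_fun expr0n oppr0 expR0.
  have cdW (t : R) : 0 < t -> {for t,
    continuous (fun t : R => -2 * (t * gauss_fun t))}.
    by move=> _; apply: continuousM; [exact: cst_continuous|exact: cW].
  have := integration_by_parts_wave 0 1 y iW (integrable_gt0Z (-2) itW)
    (fun t _ => dW t) cdW g0 (@cvg_gauss_fun R).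
  rewrite mulr0 oppr0 (wave_transform_linear 1 _ _ iW) ?oppr0 mul0r addr0 mul1r
    -/(Q y).
  have -> : wave_transform (fun t => -2 * (t * gauss_fun t)) 0 1 y = -2 * S y.
    rewrite /S /wave_transform -RintegralZl//; last exact: integrable_waveM.
    by apply: eq_Rintegral => t _; rewrite mulrA.
  by move=> h; rewrite -[RHS]subr0 -h; ring.
have dP (y : R) : is_derive y 1 (fun y => Q y * expR (4^-1 * (y * y))) 0.
  have d := is_derive_scale 4^-1 (is_derive_mul (is_derive_id y 1)
    (is_derive_id y 1)).
  have d2 := @is_derive_chain _ expR (fun t => 4^-1 * (t * t)) y _ _
    (is_derive_expR _) d.
  apply: (is_derive_eq (is_derive_mul (dQ y) d2)).
  have -> : S y = 2^-1 * (y * Q y) by rewrite -ibp mulKf.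
  by field.
have := is_derive_0_is_cst x 0 dP.
rewrite mulr0 mulr0 expR0 mulr1.
have -> : Q 0 = Num.sqrt pi / 2.
  rewrite /Q /wave_transform /Rintegral.
  under eq_integral do rewrite /wave mulr0 cos0 sin0 mulr0 addr0 !mulr1.
  rewrite integral_itv_obnd_cbnd ?integral0y_gauss//.
  apply/measurable_EFinP; exact: measurable_funTS (@measurable_gauss_fun R).
move=> <-; rewrite -/(Q x) -mulrA -expRD.
have -> : 4^-1 * (x * x) + - (x ^+ 2 / 4) = 0 by rewrite expr2; ring.
by rewrite expR0 mulr1.
Qed.

End wave.

(** * Fubini and Tonelli on the open quadrant *)

Section fubini_half_line.
Variable R : realType.
Local Notation mu := (@lebesgue_measure R).
Local Notation Rpos := (`]0%R, +oo[%classic : set R).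

(** Indicators turn the quadrant into the whole plane, where the theorems for the product measure
    apply. *)
Lemma integral_quadrant (f : R * R -> R) :
  (\int[mu]_x \int[mu]_y (f (x, y) * (\1_Rpos x * \1_Rpos y))%:E =
   \int[mu]_(x in Rpos) \int[mu]_(y in Rpos) (f (x, y))%:E)%E.
Proof.
rewrite [RHS]integral_mkcond; apply: eq_integral => x _.
rewrite patchE indicE; case: ifP => _.
  rewrite [RHS]integral_mkcond; apply: eq_integral => y _.
  by rewrite patchE indicE mul1r; case: ifP => _; rewrite ?mulr1 ?mulr0.
by apply: integral0_eq => y _; rewrite mul0r mulr0.
Qed.

Lemma integral_quadrant_swap (f : R * R -> R) :
  (\int[mu]_y \int[mu]_x (f (x, y) * (\1_Rpos x * \1_Rpos y))%:E =
   \int[mu]_(y in Rpos) \int[mu]_(x in Rpos) (f (x, y))%:E)%E.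
Proof.
rewrite -(integral_quadrant (fun z => f (z.2, z.1))).
by apply: eq_integral => y _; apply: eq_integral => x _;
  rewrite [\1__ y * _]mulrC.
Qed.

Lemma measurable_quadrant (f : R * R -> R) : measurable_fun setT f ->
  measurable_fun setT (fun z => (f z * (\1_Rpos z.1 * \1_Rpos z.2))%:E).
Proof.
move=> mf; apply/measurable_EFinP; apply: measurable_funM => //.
by apply: measurable_funM; apply: measurableT_comp => //;
  exact: measurable_indic.
Qed.

Lemma tonelli_quadrant (f : R * R -> R) : measurable_fun setT f ->
  (forall x y : R, 0 < x -> 0 < y -> 0 <= f (x, y)) ->
  (\int[mu]_(x in Rpos) \int[mu]_(y in Rpos) (f (x, y))%:E =
   \int[mu]_(y in Rpos) \int[mu]_(x in Rpos) (f (x, y))%:E)%E.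
Proof.
move=> mf f0; rewrite -integral_quadrant -integral_quadrant_swap.
have g0 (z : R * R) : (0 <= (f z * (\1_Rpos z.1 * \1_Rpos z.2))%:E)%E.
  case: z => x y; rewrite lee_fin !indicE /= !mem_setE !in_itv/= !andbT.
  case: ltP => x0; case: ltP => y0; rewrite ?mul0r ?mulr0 ?mulr1//.
  exact: f0.
exact: (@fubini_tonelli _ _ _ _ R mu mu _ (measurable_quadrant mf) g0).
Qed.

(** The first conclusion later yields the integrability of the second difference. *)
Lemma fubini_quadrant (f : R * R -> R) : measurable_fun setT f ->
  (\int[mu]_(x in Rpos) \int[mu]_(y in Rpos) `|f (x, y)|%:E < +oo)%E ->
  mu.-integrable Rpos (fun x => \int[mu]_(y in Rpos) (f (x, y))%:E)%E /\
  (\int[mu]_(x in Rpos) \int[mu]_(y in Rpos) (f (x, y))%:E =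
   \int[mu]_(y in Rpos) \int[mu]_(x in Rpos) (f (x, y))%:E)%E.
Proof.
move=> mf foo.
pose g (z : R * R) := (f z * (\1_Rpos z.1 * \1_Rpos z.2))%:E.
have ig : (mu \x mu)%E.-integrable setT g.
  apply/integrable12ltyP; first exact: measurable_quadrant.
  rewrite (_ : (\int[mu]_x _)%E = (\int[mu]_(x in Rpos) \int[mu]_(y in Rpos)
    `|f (x, y)|%:E)%E)//.
  rewrite -(integral_quadrant (fun z => `|f z|)).
  apply: eq_integral => x _; apply: eq_integral => y _.
  by rewrite /g/= !normrM !indicE !normr_nat.
split; last first.
  by rewrite -integral_quadrant -integral_quadrant_swap; exact: (Fubini ig).
apply/integrable_mkcond => //.
have := integrable_fubini_F ig; apply: eq_integrable => // x _.
rewrite /fubini_F /g /= patchE indicE; case: ifP => _.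
  rewrite [RHS]integral_mkcond; apply: eq_integral => y _.
  by rewrite patchE indicE mul1r; case: ifP => _; rewrite ?mulr1 ?mulr0.
by apply: integral0_eq => y _; rewrite mul0r mulr0.
Qed.

End fubini_half_line.

(** * Positivity of Gamma, bounds on the cosine, Gaussian moments *)

Section constant.
Variable R : realType.
Local Notation mu := (@lebesgue_measure R).
Local Notation Rpos := (`]0%R, +oo[%classic : set R).

(** On [[1, 2]] the weight is at least [m]: the power [t ^ (s - 1)] is monotone in [t], so it is
    bounded below by its value at 1 or at 2, according to the sign of [s - 1]. *)
Lemma Gamma_gt0 (s : R) : 0 < s -> 0 < Gamma s.
Proof.
move=> s0; pose m : R := Num.min 1 (2 `^ (s - 1)) * expR (- 2).
have m0 : 0 < m by rewrite mulr_gt0 ?expR_gt0// lt_min ltr01 powR_gt0.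
have iw := integrable_Gamma_weight s0.
have sub : `[1, 2]%classic `<=` Rpos.
  by move=> t; rewrite /= !in_itv/= andbT => /andP[+ _]; apply: lt_le_trans.
have mw : measurable_fun Rpos (Gamma_weight s).
  by apply/measurable_EFinP; exact: measurable_int iw.
rewrite GammaE -lte_fin /Rintegral fineK; last exact: integrable_fin_num iw.
apply: (@lt_le_trans _ _ (\int[mu]_(t in `[1%R,
  2%R]) (Gamma_weight s t)%:E)%E); last first.
  apply: ge0_subset_integral => //; first exact/measurable_EFinP.
  by move=> t _; rewrite lee_fin Gamma_weight_ge0.
apply: (@lt_le_trans _ _ (\int[mu]_(t in `[1%R, 2%R]) m%:E)%E).
  have m1 : mu `[1%R, 2%R]%classic = (2 - 1)%:E.
    by rewrite lebesgue_measure_itv/= lte_fin ltr1n -EFinD.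
  by rewrite integral_cst//= [X in (_ * X)%E]m1 -EFinM lte_fin mulr_gt0//
    subr_gt0 ltr1n.
apply: ge0_le_integral => //.
- by move=> t _; rewrite lee_fin ltW.
- by apply/measurable_EFinP; apply: measurable_funS mw.
move=> t; rewrite /= in_itv/= => /andP[t1 t2]; rewrite lee_fin.
have t0 : 0 < t by exact: lt_le_trans t1.
rewrite ler_pM ?expR_ge0 ?ler_expR ?lerN2// ?le_min ?ler01 ?powR_ge0//.
rewrite ge_min; have [s1|s1] := lerP 1 s.
  have : 1 `^ (s - 1) <= t `^ (s - 1).
    by rewrite ge0_ler_powR ?nnegrE ?subr_ge0 ?ler01 ?(ltW t0).
  by rewrite powR1 => ->.
apply/orP; right; have -> : s - 1 = - (1 - s) by ring.
rewrite !powRN lef_pV2 ?posrE ?powR_gt0//.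
by rewrite ge0_ler_powR ?nnegrE ?subr_ge0 ?(ltW s1) ?(ltW t0).
Qed.

Lemma sin_le_id (x : R) : 0 <= x -> sin x <= x.
Proof.
move=> x0; rewrite -subr_ge0.
have d (y : R) : is_derive y 1 (fun y : R => y - sin y) (1 - cos y).
  exact: is_deriveB (is_derive_id y 1) (is_derive_sin y).
have := @ger0_derive1_ndecry R (fun y : R => y - sin y) 0 _ _ _ 0 x (lexx 0) x0.
rewrite sin0 subr0; apply.
- by move=> y _; apply: ex_derive; exact: d.
- by move=> y _; rewrite derive1E (derive_val (is_derive :=
  d y)) subr_ge0 cos_le1.
- by apply: continuous_subspaceT => y; apply: is_derive_continuous; exact: d.
Qed.

Lemma oppr_le_sin (x : R) : 0 <= x -> - x <= sin x.
Proof.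
move=> x0; rewrite -subr_ge0 opprK.
have d (y : R) : is_derive y 1 (fun y : R => sin y + y) (cos y + 1).
  exact: is_deriveD (is_derive_sin y) (is_derive_id y 1).
have := @ger0_derive1_ndecry R (fun y : R => sin y + y) 0 _ _ _ 0 x (lexx 0) x0.
rewrite sin0 addr0; apply.
- by move=> y _; apply: ex_derive; exact: d.
- by move=> y _; rewrite derive1E (derive_val (is_derive :=
  d y)) -lerBlDr sub0r cos_geN1.
- by apply: continuous_subspaceT => y; apply: is_derive_continuous; exact: d.
Qed.

(** The quadratic bound comes from [1 - cos y = 2 * sin (y / 2) ^ 2] and [|sin z| <= z]. *)
Lemma one_sub_cos_le (y : R) : 0 < y -> `|1 - cos y| <= 2 * Num.min 1 (y ^+ 2).
Proof.
move=> y0; rewrite ger0_norm ?subr_ge0 ?cos_le1// -ler_pdivrMl// le_min.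
apply/andP; split.
  by rewrite ler_pdivrMl// mulr1; have := cos_geN1 y; lra.
have -> : 1 - cos y = 2 * sin (y / 2) ^+ 2.
  have e : y = (y / 2) *+ 2 by rewrite -mulr_natr divfK.
  by rewrite [in LHS]e cos_mulr2n cos2sin2; ring.
rewrite mulKf//; have z0 : 0 <= y / 2 by rewrite divr_ge0// ltW.
have := sin_le_id z0; have := oppr_le_sin z0; set u := sin _ => h1 h2.
rewrite (@le_trans _ _ ((y / 2) ^+ 2))//.
  rewrite -subr_ge0 subr_sqr mulr_ge0 ?subr_ge0//.
  by rewrite addrC -lerBlDr sub0r.
by rewrite ler_pXn2r ?nnegrE ?(ltW y0)// ler_pdivrMr// ler_peMr ?(ltW y0)//
  ler1n.
Qed.

Lemma powR_cvgy (p : R) : 0 < p ->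
  t `^ p @[t --> +oo] --> (+oo%R : set_system R).
Proof.
move=> p0; apply/cvgryPge => A; near=> t.
have t0 : 0 <= t by near: t; exact: nbhs_pinfty_ge.
pose B := Num.max 0 A; have B0 : 0 <= B by rewrite le_max lexx.
have AB : A <= (B `^ p^-1) `^ p.
  by rewrite -powRrM mulVf ?gt_eqF// powRr1// le_max lexx orbT.
apply: (le_trans AB); rewrite ge0_ler_powR ?nnegrE ?powR_ge0 ?(ltW p0)//.
Unshelve. all: by end_near. Qed.

(** The substitution [y = c ^ (- 1 / 2) * t ^ (1 / 2)], under which [c * y ^ 2 = t]. *)
Lemma integral_powR_gauss (q c : R) : 0 < q -> 0 < c ->
  (\int[mu]_(y in Rpos) (y `^ (2 * q - 1) * expR (- (c * y ^+ 2)))%:E =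
   (2^-1 * c `^ (- q) * Gamma q)%:E)%E.
Proof.
move=> q0 c0.
pose k := c `^ (- 2^-1).
have k0 : 0 < k by exact: powR_gt0.
pose F (t : R) := k * t `^ 2^-1.
pose phi (t : R) := k * (2^-1 * t `^ (2^-1 - 1)).
pose f (y : R) := y `^ (2 * q - 1) * expR (- (c * y ^+ 2)).
have h2 : 0 < 2^-1 :> R by rewrite invr_gt0.
transitivity (\int[mu]_(t in Rpos) (f (F t) * phi t)%:E)%E; last first.
  transitivity (\int[mu]_(t in Rpos)
    (2^-1 * c `^ (- q) * Gamma_weight q t)%:E)%E.
    apply: eq_integral => t; rewrite inE/= in_itv/= andbT => t0; congr (_%:E).
    have t2 : 0 <= t `^ 2^-1 by exact: powR_ge0.
    have E1 : c * F t ^+ 2 = t.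
      rewrite /F exprMn -!powR_mulrn ?(ltW k0)// -!powRrM mulrA mulVf ?powRr1
        ?(ltW t0)// mulNr mulVf//.
      by rewrite powR_inv1 ?(ltW c0)// mulfV ?mul1r// gt_eqF.
    rewrite /f E1 /phi /F /Gamma_weight powRM ?(ltW k0)// /k -!powRrM.
    have -> : - q = - 2^-1 * (2 * q - 1) + - 2^-1 by field.
    have -> : q - 1 = 2^-1 * (2 * q - 1) + (2^-1 - 1) by field.
    rewrite !powRD ?(gt_eqF c0) ?(gt_eqF t0) ?implybT//; ring.
  have iG := integrable_gt0Z (2^-1 * c `^ (- q)) (integrable_Gamma_weight q0).
  rewrite -[LHS]fineK; last exact: integrable_fin_num iG.
  by congr EFin; apply: RintegralZl => //; exact: integrable_Gamma_weight.
have F0 (t : R) : 0 < t -> 0 < F t by move=> t0; rewrite mulr_gt0 ?powR_gt0.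
apply: (@gt0_increasing_substitution R f F phi 0) => //.
- by move=> y y0; rewrite mulr_ge0 ?powR_ge0 ?expR_ge0.
- move=> y y0; apply: continuousM; first exact: continuous_powR.
  apply: (@continuous_comp _ _ _ (fun y : R => - (c * y ^+ 2)) expR);
    last exact: continuous_expR.
  apply: continuousN; apply: continuousM; first exact: cst_continuous.
  exact: exprn_continuous.
- by move=> t t0; exact: is_derive_scale (is_derive1_powR _ t0).
- by move=> t t0; rewrite !mulr_ge0 ?powR_ge0 ?(ltW k0) ?(ltW h2).
- move=> t t0; apply: continuousM; first exact: cst_continuous.
  by apply: continuousM; [exact: cst_continuous|exact: continuous_powR].
- rewrite /phi; have -> : 2^-1 - 1 = - 2^-1 :> R by field.
  rewrite -[X in _ --> X](mulr0 k); apply: cvgM; first exact: cvg_cst.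
  rewrite -[X in _ --> X](mulr0 2^-1); apply: cvgM; first exact: cvg_cst.
  exact: powRN_cvgy.
- move=> t u; rewrite !in_itv/= !andbT => t0 u0 tu.
  by rewrite ltr_pM2l// gt0_ltr_powR ?nnegrE ?ltW.
- rewrite -[X in _ --> X](mulr0 k); apply: cvgM; first exact: cvg_cst.
  exact: powR_cvg0.
- apply: gt0_cvgMry => //; exact: powR_cvgy.
Qed.
End constant.

(** * The normalization constant *)

Section normalization.
Variable R : realType.
Local Notation mu := (@lebesgue_measure R).
Local Notation Rpos := (`]0%R, +oo[%classic : set R).

Lemma EFin_Rintegral (D : set R) (f : R -> R) : measurable D ->
  mu.-integrable D (EFin \o f) ->
  (\int[mu]_(x in D) (f x)%:E = (\int[mu]_(x in D) f x)%R%:E)%E.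
Proof. by move=> mD intf; rewrite /Rintegral fineK//;
  exact: integrable_fin_num intf. Qed.

Lemma ge0_integrable_gt0 (f : R -> R) (l : R) : measurable_fun Rpos f ->
  (forall x : R, 0 < x -> 0 <= f x) ->
    (\int[mu]_(x in Rpos) (f x)%:E = l%:E)%E ->
  mu.-integrable Rpos (EFin \o f).
Proof.
move=> mf f0 fl; apply/integrableP; split; first exact/measurable_EFinP.
rewrite (_ : (\int[mu]_(x in _) _)%E = l%:E) ?ltry// -fl.
by apply: eq_integral => x; rewrite inE/= in_itv/= andbT => x0;
  rewrite ger0_norm// f0.
Qed.

Variable a : R.
Hypothesis a02 : 0 < a < 2.

Let a0 : 0 < a. Proof. by case/andP: a02. Qed.
Let a2 : a < 2. Proof. by case/andP: a02. Qed.

Definition cos_kernel (xi y : R) : R := (1 - cos (xi * y)) * y `^ (- (1 + a)).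

Lemma cos_kernel_ge0 xi y : 0 <= cos_kernel xi y.
Proof. by rewrite mulr_ge0 ?powR_ge0// subr_ge0 cos_le1. Qed.

Lemma continuous_cos_kernel (xi y : R) : 0 < y -> {for y,
  continuous (cos_kernel xi)}.
Proof.
move=> y0; apply: continuousM; last exact: continuous_powR.
apply: continuousD; first exact: cst_continuous.
apply: continuousN; apply: is_derive_continuous; exact: is_derive_cosM.
Qed.

Lemma integrable_cos_kernel1 : mu.-integrable Rpos (EFin \o cos_kernel 1).
Proof.
apply: (@dominated_integrable_gt0 _ _ (fun y => 2 * (Num.min 1 (y ^+ 2) * y `^
  (- (1 + a))))).
- by apply: measurable_fun_gt0 => y; exact: continuous_cos_kernel.
- move=> y y0; rewrite /cos_kernel mul1r normrM [X in _ * X]ger0_norm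
  ?powR_ge0// mulrA.
  by rewrite ler_wpM2r ?powR_ge0// one_sub_cos_le.
- exact/integrable_gt0Z/integrable_min_powR.
Qed.

Let K1 := \int[mu]_(y in Rpos) cos_kernel 1 y.

(** Under [y = z / xi] the kernel contributes [xi ^ (1 + a)] and the Jacobian [xi ^ (- 1)]. *)
Let integral_cos_kernel_scale (xi : R) : 0 < xi ->
  (\int[mu]_(y in Rpos) (cos_kernel xi y)%:E = (xi `^ a * K1)%:E)%E.
Proof.
move=> xi0; have ix0 : 0 < xi^-1 by rewrite invr_gt0.
transitivity (\int[mu]_(y in Rpos) (cos_kernel xi (xi^-1 * y) * xi^-1)%:E)%E;
  last first.
  rewrite -RintegralZl//; last exact: integrable_cos_kernel1.
  rewrite -EFin_Rintegral//; last exact/integrable_gt0Z/integrable_cos_kernel1.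
  apply: eq_integral => y; rewrite inE/= in_itv/= andbT => y0; congr EFin.
  rewrite /cos_kernel mulVKf ?gt_eqF// mul1r powRM ?(ltW y0) ?(ltW ix0)//.
  have <- : xi^-1 `^ (- (1 + a)) / xi = xi `^ a.
    rewrite -(powR_inv1 (ltW xi0)) -powRrM -powRD ?(gt_eqF xi0) ?implybT//.
    by congr (_ `^ _); ring.
  by ring.
apply: (@gt0_increasing_substitution R (cos_kernel xi) ( *%R xi^-1)
  (cst xi^-1) xi^-1).
- by move=> y _; exact: cos_kernel_ge0.
- by move=> y; exact: continuous_cos_kernel.
- by move=> y y0; rewrite mulr_gt0.
- by move=> y y0; have := is_derive_scale xi^-1 (is_derive_id y 1);
  rewrite mulr1.
- by move=> y _; rewrite ltW.
- by move=> y _; exact: cst_continuous.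
- exact: cvg_cst.
- by move=> y z _ _ yz; rewrite ltr_pM2l.
- rewrite -[X in _ --> X](mulr0 xi^-1); apply: cvgM; first exact: cvg_cst.
  exact: cvg_at_right_filter (@cvg_id _ _).
- by apply: gt0_cvgMry => //; exact: cvg_id.
Qed.

(** Up to the factor [sqrt pi / 2], the integral of [cos_kernel xi y * e ^ (- xi ^ 2)] over
    [xi > 0]. *)
Let gauss_kernel (y : R) : R :=
  (1 - expR (- (4^-1 * y ^+ 2))) * y `^ (- (1 + a)).

Let gauss_lt (y : R) : 1 - expR (- (4^-1 * y ^+ 2)) <= 4^-1 * y ^+ 2.
Proof. by have := expR_ge1Dx (- (4^-1 * y ^+ 2)); lra. Qed.

Let gauss_ge0 (y : R) : 0 <= 1 - expR (- (4^-1 * y ^+ 2)).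
Proof. by rewrite subr_ge0 expR_le1 oppr_le0 mulr_ge0 ?sqr_ge0// invr_ge0. Qed.

Let gauss_le1 (y : R) : 1 - expR (- (4^-1 * y ^+ 2)) <= 1.
Proof. by rewrite gerBl expR_ge0. Qed.

Let d_gauss (y : R) : is_derive y 1 (fun y : R => 1 - expR (- (4^-1 * y ^+ 2)))
   (2^-1 * y * expR (- (4^-1 * y ^+ 2))).
Proof.
have d := is_deriveN (is_derive_scale 4^-1 (is_derive_mul (is_derive_id y 1)
  (is_derive_id y 1))).
have d2 := @is_derive_chain _ expR (fun t => - (4^-1 * (t * t))) y _ _
  (is_derive_expR _) d.
apply: (is_derive_eq (is_derive_cstD 1 (is_deriveN d2))).
by rewrite expr2 /=; field.
Qed.

Let integrable_gauss_kernel : mu.-integrable Rpos (EFin \o gauss_kernel).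
Proof.
apply: (@dominated_integrable_gt0 _ _ (fun y => Num.min 1 (y ^+ 2) * y `^ (- (1
  + a)))).
- apply: measurable_fun_gt0 => y y0; apply: continuousM;
  last exact: continuous_powR.
  by apply: is_derive_continuous; exact: d_gauss.
- move=> y y0; rewrite ger0_norm ?mulr_ge0 ?powR_ge0//.
  rewrite ler_wpM2r ?powR_ge0// le_min gauss_le1/= (le_trans (gauss_lt _))//.
  by rewrite ler_piMl ?sqr_ge0// invf_le1// ler1n.
- exact: integrable_min_powR.
Qed.

(** Integration by parts through [(1 - e ^ (- y ^ 2 / 4)) * y ^ (- a)], which is [O(y ^ (2 - a))] at
    0 and [O(y ^ (- a))] at infinity. There remains the Gaussian moment [g], of order
    [q = 1 - a / 2]. *)
Let integral_gauss_kernel :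
  \int[mu]_(y in Rpos) gauss_kernel y = 2 `^ (- a) / a * Gamma (1 - a / 2).
Proof.
have q0 : 0 < 1 - a / 2 by have := a2; lra.
pose g (y : R) := y `^ (2 * (1 - a / 2) - 1) * expR (- (4^-1 * y ^+ 2)).
have ge : (\int[mu]_(y in Rpos)
  (g y)%:E = (2^-1 * 4^-1 `^ (- (1 - a / 2)) * Gamma (1 - a / 2))%:E)%E.
  by rewrite integral_powR_gauss.
have cg (y : R) : 0 < y -> {for y, continuous g}.
  move=> y0; apply: continuousM; first exact: continuous_powR.
  apply: (@continuous_comp _ _ _ (fun y : R => - (4^-1 * y ^+ 2)) expR);
    last exact: continuous_expR.
  apply: continuousN; apply: continuousM; first exact: cst_continuous.
  exact: exprn_continuous.
have ig : mu.-integrable Rpos (EFin \o g).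
  apply: (ge0_integrable_gt0 _ _ ge); first by apply: measurable_fun_gt0.
  by move=> y _; rewrite mulr_ge0 ?powR_ge0 ?expR_ge0.
have yE (y p : R) : 0 < y -> y * y `^ p = y `^ (p + 1).
  by move=> y0; rewrite powRD ?(gt_eqF y0) ?implybT// powRr1 ?(ltW y0)// mulrC.
have lim0 : (1 - expR (- (4^-1 * y ^+ 2))) * y `^ (- a) @[y --> 0^'+] --> (0 :
  R).
  have b0 : 0 < 2 - a by rewrite subr_gt0.
  apply: (@squeeze_cvgr _ _ _ _ (cst 0) (fun y => y `^ (2 - a))); last 2 first.
  - exact: cvg_cst.
  - exact: powR_cvg0.
  near=> y; have y0 : 0 < y by [].
  rewrite /= mulr_ge0 ?powR_ge0//= powRD ?(gt_eqF y0) ?implybT// ler_wpM2r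
    ?powR_ge0//.
  rewrite powR_mulrn ?(ltW y0)// (le_trans (gauss_lt _))//.
  by rewrite ler_piMl ?sqr_ge0// invf_le1// ler1n.
have limy : (1 - expR (- (4^-1 * y ^+ 2))) * y `^ (- a) @[y --> +oo] --> (0 :
  R).
  apply: (@squeeze_cvgr _ _ _ _ (cst 0) (fun y => y `^ (- a))); last 2 first.
  - exact: cvg_cst.
  - exact: powRN_cvgy.
  near=> y; rewrite /= mulr_ge0 ?powR_ge0//= ler_piMl ?powR_ge0//.
have i2 := integrable_gt0Z (- a) integrable_gauss_kernel.
have i1 := integrable_gt0Z 2^-1 ig.
have := FTC0y (integrable_gt0D i1 i2) _ _ lim0 limy.
rewrite subr0 RintegralD// !RintegralZl//.
have -> : \int[mu]_(y in Rpos) g y = 2^-1 * 4^-1 `^ (- (1 - a / 2)) * Gamma (1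
  - a / 2).
  by rewrite /Rintegral ge.
have -> : 4^-1 `^ (- (1 - a / 2)) = 4 * 2 `^ (- a) :> R.
  have -> : 4^-1 = 2 `^ (- 2%:R) :> R by rewrite powR_invn// -natrX.
  rewrite -powRrM; have -> : - 2%:R * - (1 - a / 2) = 2%:R + - a :> R by field.
  by rewrite powRD ?pnatr_eq0 ?implybT// powR_mulrn// -natrX.
move=> h; have {}h := h _ _.
suff e : a * \int[mu]_(y in Rpos) gauss_kernel y = 2 `^ (- a) * Gamma (1 - a /
  2).
  by rewrite mulrAC -e mulrC mulKf// gt_eqF.
apply/eqP; rewrite -subr_eq0 -oppr_eq0; apply/eqP; rewrite -[RHS]h;
  first by field.
- move=> y y0; apply: continuousD; apply: continuousM;
  try exact: cst_continuous.
    exact: cg.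
  apply: continuousM; last exact: continuous_powR.
  by apply: is_derive_continuous; exact: d_gauss.
- move=> y y0; apply: (is_derive_eq (is_derive_mul (d_gauss y)
  (is_derive1_powR (- a) y0))).
  rewrite /g /gauss_kernel.
  have -> : 2 * (1 - a / 2) - 1 = - a + 1 by field.
  rewrite -yE//; have -> : - a - 1 = - (1 + a) by ring.
  by ring.
Unshelve. all: by end_near. Qed.

(* Integrate [cos_kernel xi y * e^(- xi^2)] over the quadrant in both orders. *)
Let mean_cos_kernel :
  K1 * (2^-1 * Gamma ((1 + a) / 2)) = Num.sqrt pi / 2 * (2 `^ (- a) / a * Gamma
    (1 - a / 2)).
Proof.
have q0 : 0 < (1 + a) / 2 by rewrite divr_gt0 ?addr_gt0.
pose f (z : R * R) : R := gauss_fun z.1 * cos_kernel z.1 z.2.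
have mf : measurable_fun setT f.
  apply: measurable_funM; first by apply: measurableT_comp => //;
    exact: measurable_gauss_fun.
  apply: measurable_funM.
    apply: measurable_funB => //.
    apply: measurableT_comp => //; last exact: measurable_funM.
    apply: continuous_measurable_fun; exact: continuous_cos.
  by apply: (measurableT_comp (measurable_powR _)).
have f0 (x y : R) : 0 < x -> 0 < y -> 0 <= f (x, y).
  by move=> _ _; rewrite mulr_ge0 ?gauss_fun_ge0 ?cos_kernel_ge0.
have := tonelli_quadrant mf f0.
rewrite (_ : (\int[mu]_(x in Rpos) _)%E = (K1 * (2^-1 * Gamma ((1 + a) /
  2)))%:E); last first.
  transitivity (\int[mu]_(x in Rpos)
    (K1%:E * (x `^ a * expR (- (1 * x ^+ 2)))%:E))%E.
    apply: eq_integral => x; rewrite inE/= in_itv/= andbT => x0.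
    transitivity (\int[mu]_(y in Rpos)
      ((gauss_fun x)%:E * (cos_kernel x y)%:E))%E.
      by apply: eq_integral => y _; rewrite -EFinM.
    rewrite ge0_integralZl_EFin ?gauss_fun_ge0//; last 2 first.
    - by move=> y _; rewrite lee_fin cos_kernel_ge0.
    - apply/measurable_EFinP; apply: measurable_fun_gt0 => y;
      exact: continuous_cos_kernel.
    rewrite integral_cos_kernel_scale// -!EFinM /gauss_fun mul1r.
    by congr EFin; ring.
  have aE : a = 2 * ((1 + a) / 2) - 1 by field.
  rewrite ge0_integralZl_EFin//.
  - by rewrite {1}aE integral_powR_gauss// powR1 mulr1 -EFinM.
  - by move=> y _; rewrite lee_fin mulr_ge0 ?powR_ge0 ?expR_ge0.
  - apply/measurable_EFinP; apply: measurable_funM.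
      exact: measurable_funTS (measurable_powR _).
    rewrite (_ : (fun y : R => expR (- (1 * y ^+ 2))) = @gauss_fun R).
      exact: measurable_funTS (@measurable_gauss_fun R).
    by apply/funext => y; rewrite mul1r.
  - by apply: Rintegral_ge0 => y _; exact: cos_kernel_ge0.
rewrite (_ : (\int[mu]_(x in Rpos) _)%E = (Num.sqrt pi / 2 * (2 `^ (- a) / a *
  Gamma (1 - a / 2)))%:E).
  by move=> [].
rewrite -integral_gauss_kernel -RintegralZl// -EFin_Rintegral//;
  last exact: integrable_gt0Z.
apply: eq_integral => y; rewrite inE/= in_itv/= andbT => y0.
have iG : mu.-integrable Rpos (EFin \o @gauss_fun R).
  exact: integrableS (@integrableT_gauss R).
(* [1 - cos (x * y)] is a difference of waves at the points 0 and [y], so the inner integral is a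
   difference of two known cosine transforms of the Gaussian. *)
transitivity (\int[mu]_(x in Rpos)
  ((y `^ (- (1 + a)))%:E * (gauss_fun x * wave 1 0 (x * 0) - gauss_fun x * wave
  1 0 (x * y))%:E))%E.
  apply: eq_integral => x _; rewrite -EFinM /f /cos_kernel /wave mulr0 cos0;
    congr EFin; ring.
rewrite ge0_integralZl_EFin ?powR_ge0//; last 2 first.
- move=> x _; rewrite lee_fin -mulrBr mulr_ge0 ?gauss_fun_ge0//.
  by rewrite /wave mulr0 cos0 !mul1r !mul0r !addr0 subr_ge0 cos_le1.
- by apply/measurable_EFinP; apply: measurable_funB; apply/measurable_EFinP;
  exact: measurable_int (integrable_waveM _ _ _ iG).
rewrite EFin_Rintegral//; last first.
  exact: (@integrableB _ _ R mu _ (measurable_itv _) _ _ (integrable_waveM 1 0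
    0 iG) (integrable_waveM 1 0 y iG)).
rewrite RintegralB//; try exact: integrable_waveM.
rewrite -!/(wave_transform _ _ _ _) !wave_transform_gauss -EFinM /gauss_kernel;
  congr EFin.
rewrite expr0n mul0r oppr0 expR0 [y ^+ 2 / 4]mulrC; ring.
Qed.

(** Solving the Gaussian identity for [K1]. This is where the explicit value of the constant enters;
    the 2 reflects that only one of two equal half-lines is integrated. *)
Lemma integral_cos_kernel (xi : R) : 0 < xi ->
  (\int[mu]_(y in Rpos) (cos_kernel xi y)%:E =
   (xi `^ a / (2 * fracLaplacian_const a))%:E)%E.
Proof.
move=> xi0; rewrite integral_cos_kernel_scale//; congr (_ * _)%:E.
have q0 : 0 < (1 + a) / 2 by rewrite divr_gt0 ?addr_gt0.
have p0 : 0 < 1 - a / 2 by have := a2; lra.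
have G1 := Gamma_gt0 q0; have G2 := Gamma_gt0 p0.
have sp : 0 < Num.sqrt (pi : R) by rewrite sqrtr_gt0 pi_gt0.
have t0 : 0 < 2 `^ a :> R by rewrite powR_gt0.
have -> : K1 = Num.sqrt pi * (2 `^ (- a) / a * Gamma (1 - a / 2)) / Gamma ((1 +
  a) / 2).
  have -> : K1 = 2 * (K1 * (2^-1 * Gamma ((1 + a) / 2))) / Gamma ((1 + a) / 2)
    by field; rewrite gt_eqF.
  by rewrite mean_cos_kernel; field; rewrite !gt_eqF.
rewrite /fracLaplacian_const powRN powRD ?pnatr_eq0 ?implybT// powR_inv1//.
rewrite -mulrDl.
by field; rewrite !gt_eqF.
Qed.

End normalization.

(** * The fractional Laplacian as a Fourier multiplier *)

Section multiplier.
Variable R : realType.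
Local Notation mu := (@lebesgue_measure R).
Local Notation Rpos := (`]0%R, +oo[%classic : set R).
Variable a : R.
Hypothesis a02 : 0 < a < 2.

Lemma fracLaplacian_const_gt0 : 0 < fracLaplacian_const a.
Proof.
case/andP: a02 => a0 a2.
have G1 : 0 < Gamma (1 / 2 + a / 2) by apply: Gamma_gt0; lra.
have G2 : 0 < Gamma (1 - a / 2) by apply: Gamma_gt0; lra.
rewrite /fracLaplacian_const mulr_gt0// divr_gt0 ?mulr_gt0 ?powR_gt0//.
by rewrite sqrtr_gt0 pi_gt0.
Qed.

Variable w : R -> R.
Hypothesis mw : measurable_fun setT w.
Hypothesis iw : mu.-integrable Rpos (EFin \o w).
Hypothesis iaw : mu.-integrable Rpos (EFin \o (fun t => t `^ a * w t)).
Variables p q : R.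

Let u := wave_transform w p q.
(** The pair is [(y, t)]. Integrating out [t] gives the second difference of [u], integrating out
    [y] the density multiplied by [t ^ a]. *)
Let f x (z : R * R) := 2 * (w z.2 * wave p q (z.2 * x)) * cos_kernel a z.2 z.1.

Let measurable_f x : measurable_fun setT (f x).
Proof.
have mwave : measurable_fun setT (fun t : R => wave p q (t * x)).
  by apply: continuous_measurable_fun => t; exact: continuous_wave_mulr.
apply: measurable_funM.
  apply: measurable_funM => //; apply: measurable_funM.
    exact: (measurableT_comp mw).
  exact: (measurableT_comp mwave).
apply: measurable_funM.
  apply: measurable_funB => //.
  apply: measurableT_comp => //; last exact: measurable_funM.
  by apply: continuous_measurable_fun; exact: continuous_cos.
exact: (measurableT_comp (measurable_powR _)).
Qed.

Let integral_f2 x t : 0 < t ->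
  (\int[mu]_(y in Rpos) (f x (y, t))%:E =
   (t `^ a * w t * wave p q (t * x) / fracLaplacian_const a)%:E)%E.
Proof.
move=> t0; have c0 := fracLaplacian_const_gt0.
have ik : mu.-integrable Rpos (EFin \o cos_kernel a t).
  apply: (ge0_integrable_gt0 _ _ (integral_cos_kernel a02 t0)).
    by apply: measurable_fun_gt0 => y; exact: continuous_cos_kernel.
  by move=> y _; exact: cos_kernel_ge0.
transitivity (\int[mu]_(y in Rpos)
  (2 * (w t * wave p q (t * x)) * cos_kernel a t y)%:E)%E.
  exact: eq_integral.
rewrite EFin_Rintegral//; last exact: integrable_gt0Z.
rewrite RintegralZl// /Rintegral (integral_cos_kernel a02 t0)/=.
by congr EFin; field; rewrite gt_eqF.
Qed.

(** By Tonelli, [y] may be integrated first. The kernel is nonnegative, so its integral is exact and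
    leaves [t ^ a * |w t|] times a bounded wave. *)
Let integral_abs_f x :
  (\int[mu]_(y in Rpos) \int[mu]_(t in Rpos) `|f x (y, t)|%:E < +oo)%E.
Proof.
have c0 := fracLaplacian_const_gt0.
rewrite (@tonelli_quadrant R (fun z => `|f x z|)) //;
  last exact: measurableT_comp.
have ib : mu.-integrable Rpos (EFin \o (fun t => (`|p| + `|q|) /
  fracLaplacian_const a * `|t `^ a * w t|)).
  by apply: integrable_gt0Z; exact: integrable_abse iaw.
have /integrableP[mb] := ib; apply: le_lt_trans.
have ae t y : `|f x (y, t)| = 2 * `|w t * wave p q (t * x)| * cos_kernel a t y.
  by rewrite /f /= normrM [X in _ * X]ger0_norm ?cos_kernel_ge0// normrM
    normr_nat.
rewrite (_ : (\int[mu]_(t in Rpos) _)%E = \int[mu]_(t in Rpos)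
  (`|t `^ a * w t * wave p q (t * x)| / fracLaplacian_const a)%:E)%E;
  last first.
  apply: eq_integral => t; rewrite inE/= in_itv/= andbT => t0.
  have ik : mu.-integrable Rpos (EFin \o cos_kernel a t).
    apply: (ge0_integrable_gt0 _ _ (integral_cos_kernel a02 t0)).
      by apply: measurable_fun_gt0 => y; exact: continuous_cos_kernel.
    by move=> y _; exact: cos_kernel_ge0.
  under eq_integral do rewrite ae.
  rewrite EFin_Rintegral//; last exact: integrable_gt0Z.
  rewrite RintegralZl// /Rintegral (integral_cos_kernel a02 t0)/=.
  rewrite !normrM (ger0_norm (powR_ge0 t a)).
  by congr EFin; field; rewrite gt_eqF.
have mW : measurable_fun Rpos (fun t => t `^ a * w t * wave p q (t * x)).
  by have /measurable_int/measurable_EFinP := integrable_waveM p q x iaw.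
apply: ge0_le_integral => //.
- by move=> t _; rewrite lee_fin divr_ge0// ltW.
- apply/measurable_EFinP; apply: measurable_funM => //.
  exact: measurableT_comp.
- exact: measurableT_comp.
move=> t _; rewrite gee0_abs ?lee_fin; last first.
  by rewrite mulr_ge0// divr_ge0 ?addr_ge0// ltW.
rewrite normrM [leRHS]mulrAC ler_wpM2r ?invr_ge0 ?(ltW c0)//.
by rewrite mulrC ler_wpM2r// norm_wave_le.
Qed.

(** The sum of the principal-value integrands at [y] and [- y], for [y > 0]. *)
Definition second_difference_kernel (v : R -> R) x y :=
  (2 * v x - v (x + y) - v (x - y)) * y `^ (- (1 + a)).

Let integral_f1 x y : 0 < y ->
  (\int[mu]_(t in Rpos) (f x (y,
    t))%:E = (second_difference_kernel u x y)%:E)%E.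
Proof.
move=> y0.
have iW v : mu.-integrable Rpos (EFin \o (fun t => w t * wave p q (t * v))) by
  exact: integrable_waveM.
transitivity (\int[mu]_(t in Rpos)
  ((fun t => y `^ (- (1 + a)) * (2 * (w t * wave p q (t * x))
    + - 1 * (w t * wave p q (t * (x + y))) + - 1 * (w t * wave p q (t * (x -
      y))))) t)%:E)%E.
  apply: eq_integral => t _; rewrite /f /=; congr EFin.
  have := wave_second_difference p q (t * x) (t * y).
  rewrite -mulrDr -mulrBr => E; rewrite /cos_kernel.
  transitivity (w t * (2 * wave p q (t * x) * (1 - cos (t * y))) * y `^ (- (1 +
    a))); first by ring.
  by rewrite -E; ring.
have jx := integrable_gt0Z 2 (iW x).
have jp := integrable_gt0Z (-1) (iW (x + y)).
have jm := integrable_gt0Z (-1) (iW (x - y)).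
have j1 := integrable_gt0D jx jp.
have j2 := integrable_gt0D j1 jm.
rewrite (EFin_Rintegral (measurable_itv _)
  (integrable_gt0Z (y `^ (- (1 + a))) j2)).
rewrite (Rintegral_gt0Z _ j2) (Rintegral_gt0D j1 jm) (Rintegral_gt0D jx jp).
rewrite (Rintegral_gt0Z _ (iW x)) (Rintegral_gt0Z _ (iW (x + y)))
  (Rintegral_gt0Z _ (iW (x - y))).
rewrite -!/(wave_transform _ _ _ _) -!/(u _) /second_difference_kernel;
  congr EFin.
by ring.
Qed.

(** Fubini for [f x]. Integrability near [y = 0] comes from the double integral, with no estimate on
    the regularity of [u]. *)
Lemma second_difference_wave_transform x :
  mu.-integrable Rpos (EFin \o second_difference_kernel u x) /\
  \int[mu]_(y in Rpos) second_difference_kernel u x y =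
    (fracLaplacian_const a)^-1 * wave_transform (fun t => t `^ a * w t) p q x.
Proof.
have [i1 E] := fubini_quadrant (measurable_f x) (integral_abs_f x).
have ik : mu.-integrable Rpos (EFin \o second_difference_kernel u x).
  have E1 : {in Rpos, (fun y => \int[mu]_(t in Rpos) (f x (y, t))%:E)%E =1
      EFin \o second_difference_kernel u x}.
    by move=> y; rewrite inE/= in_itv/= andbT => y0; exact: integral_f1.
  exact: (@eq_integrable _ _ R mu Rpos (measurable_itv _) _ _ E1 i1).
split; first exact: ik.
have iV := integrable_waveM p q x iaw.
apply: EFin_inj; rewrite -(EFin_Rintegral (measurable_itv _) ik).
transitivity (\int[mu]_(y in Rpos) \int[mu]_(t in Rpos) (f x (y, t))%:E)%E.
  by apply: eq_integral => y; rewrite inE/= in_itv/= andbT => y0;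
    rewrite integral_f1.
rewrite E /wave_transform -(Rintegral_gt0Z _ iV).
rewrite -(EFin_Rintegral (measurable_itv _) (integrable_gt0Z _ iV)).
apply: eq_integral => t; rewrite inE/= in_itv/= andbT => t0.
rewrite (integral_f2 x t0); congr EFin; exact: mulrC.
Qed.

End multiplier.

(** * From the second difference to the principal value *)

Section principal_value.
Variable R : realType.
Local Notation mu := (@lebesgue_measure R).
Local Notation Rpos := (`]0%R, +oo[%classic : set R).

(** Lebesgue measure is its own image under [-%R], so this is the change of variables for a
    pushforward measure. *)
Lemma integrable_opp (D : set R) (f : R -> R) : measurable D ->
  measurable_fun setT f ->
  mu.-integrable (-%R @^-1` D) (EFin \o (fun x => f (- x))) ->
  mu.-integrable D (EFin \o f) /\
  \int[mu]_(x in D) f x = \int[mu]_(x in -%R @^-1` D) f (- x).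
Proof.
move=> mD mf intf.
have mopp : @measurable_fun _ _ (measurableTypeR R)
  (measurableTypeR R) setT -%R by [].
have mEf : @measurable_fun _ _ (measurableTypeR R) _ setT (EFin \o f) by
  exact/measurable_EFinP.
have /integrableP[_ h] := @integrable_pushforward _ _ (measurableTypeR R)
  (measurableTypeR R) R -%R mopp mu D (EFin \o f) mEf intf mD.
split.
  apply/integrableP; split; first exact: measurable_funTS.
  apply: le_lt_trans h; rewrite le_eqVlt; apply/orP; left; apply/eqP.
  by apply: eq_measure_integral => // A mA _; exact/esym/lebesgue_measureN.
rewrite /Rintegral; congr fine.
transitivity (\int[pushforward mu (-%R : measurableTypeR R ->
  measurableTypeR R)]_(x in D) (EFin \o f) x)%E.
  by apply: eq_measure_integral => // A mA _; exact/esym/lebesgue_measureN.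
exact: (@integral_pushforward _ _ (measurableTypeR R)
  (measurableTypeR R) R -%R mopp mu D (EFin \o f) mEf intf mD).
Qed.

(** The right limit is tested on positive sequences tending to 0; along each of them [|h|] dominates
    the truncations. *)
Lemma integrable_itvoy_cvg (h : R -> R) : mu.-integrable Rpos (EFin \o h) ->
  \int[mu]_(y in `]eps, +oo[) h y @[eps --> 0^'+] --> \int[mu]_(y in Rpos) h y.
Proof.
move=> ih; apply/cvg_at_rightP => v [v0 vto0].
have sub n : `]v n, +oo[%classic `<=` Rpos.
  by move=> y; rewrite /= !in_itv/= !andbT; exact: lt_trans.
have mh : measurable_fun Rpos h by apply/measurable_EFinP;
  exact: measurable_int ih.
have H : (\int[mu]_(y in Rpos) (h \_ `]v n, +oo[ y)%:E @[n --> \oo] -->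
          \int[mu]_(y in Rpos) (h y)%:E)%E.
  have [|||||_ _] := @dominated_convergence _ _ R mu Rpos
    (measurable_itv _) (fun n => EFin \o (h \_ `]v n, +oo[)) (EFin \o h)
    (abse \o (EFin \o h)) => //.
  - move=> n; apply/measurable_EFinP.
    apply/measurable_restrict => //.
    by apply: (measurable_funS _ _ mh) => // x [].
  - exact/measurable_EFinP.
  - apply: aeW => x /=; rewrite in_itv/= andbT => x0.
    apply: cvg_EFin; first exact: nearW.
    apply: cvg_near_cst; near=> n;
      rewrite /= patchE mem_set// /= in_itv/= andbT.
    by near: n; move/cvgr_lt : vto0; exact.
  - exact: integrable_abse.
  - apply: aeW => x /= n _; rewrite patchE lee_fin; case: ifPn => //.
    by rewrite normr0.
have Fin : (\int[mu]_(y in Rpos)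
  (h y)%:E)%E \is a fin_num by exact: integrable_fin_num ih.
rewrite -(fineK Fin) in H.
rewrite (_ : (fun n => _) = fine \o (fun n => \int[mu]_(y in Rpos) (h \_ `]v n,
  +oo[ y)%:E)%E).
  exact: (fine_cvg H).
apply/funext => n /=.
rewrite /Rintegral; congr fine.
transitivity (\int[mu]_(y in Rpos) ((EFin \o h) \_ `]v n, +oo[) y)%E.
  by rewrite -integral_mkcondr setIC setIidl//; exact: sub.
by apply: eq_integral => y _; rewrite !patchE; case: ifP.
Unshelve. all: by end_near. Qed.

Variable a : R.
Hypothesis a02 : 0 < a < 2.

(** For [y > eps], [min 1 (y ^ 2)] is at least [min 1 (eps ^ 2)], so the common majorant applies. *)
Lemma integrable_powR_itvoy (eps : R) : 0 < eps ->
  mu.-integrable `]eps, +oo[ (EFin \o (fun y => y `^ (- (1 + a)))).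
Proof.
move=> e0.
have i1 : mu.-integrable `]eps,
  +oo[ (EFin \o (fun y => (Num.min 1 (eps ^+ 2))^-1 *
   (Num.min 1 (y ^+ 2) * y `^ (- (1 + a))))).
  apply: integrableS (integrable_gt0Z _ (integrable_min_powR a02)) => //.
  by move=> y; rewrite /= !in_itv/= !andbT; exact: lt_trans.
apply: le_integrable i1 => //.
  apply/measurable_EFinP; exact: measurable_funTS (measurable_powR _).
move=> y; rewrite /= in_itv/= andbT => ey.
have y0 : 0 < y by exact: lt_trans ey.
have m0 : 0 < Num.min 1 (eps ^+ 2) by rewrite lt_min ltr01 exprn_gt0.
rewrite lee_fin !ger0_norm ?mulr_ge0 ?powR_ge0 ?invr_ge0 ?le_min ?ler01
  ?sqr_ge0//.
rewrite mulrA ler_peMl ?powR_ge0// mulrC ler_pdivlMr// mul1r.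
by rewrite le_min !ge_min lexx/= ler_pXn2r ?nnegrE ?(ltW e0) ?(ltW y0)// (ltW
  ey) orbT.
Qed.

(** Boundedness of [v] makes each truncation integrable, hence separable into two half-lines.
    Reflecting the negative one produces the second difference on []eps, +oo[], which is integrable
    up to 0. *)
Lemma is_pv_integral_symmetric (v : R -> R) (M L x : R) :
  measurable_fun setT v -> (forall y, `|v y| <= M) ->
  mu.-integrable Rpos (EFin \o second_difference_kernel a v x) ->
  \int[mu]_(y in Rpos) second_difference_kernel a v x y = L ->
  is_pv_integral (fun y => (v x - v (x + y)) / `|y| `^ (1 + a)) L.
Proof.
move=> mv vM ik kL; pose f y := (v x - v (x + y)) / `|y| `^ (1 + a).
have mf : measurable_fun setT f.
  apply: measurable_funM.
    apply: measurable_funB => //.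
    by apply: measurableT_comp => //; exact: measurable_funD.
  rewrite (_ : (fun y => (`|y| `^ (1 + a))^-1) = (fun y => `|y| `^ (- (1 +
    a)))); last first.
    by apply/funext => y; rewrite powRN.
  by apply: (measurableT_comp (measurable_powR _)).
(* The sign [s] treats the two half-lines together. *)
have fb (s : R) (eps : R) : `|s| = 1 -> 0 < eps -> mu.-integrable `]eps,
  +oo[ (EFin \o (fun y => f (s * y))).
  move=> s1 e0.
  have i1 := integrable_powR_itvoy e0.
  have i2 : mu.-integrable `]eps,
    +oo[ (EFin \o (fun y => (M + M) * y `^ (- (1 + a)))).
    exact: (@integrableZl _ _ R mu _ (measurable_itv _) (M + M) _ i1).
  apply: le_integrable i2 => //.
    apply/measurable_EFinP; apply: measurable_funTS;
      apply: measurableT_comp => //; exact: measurable_funM.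
  move=> y; rewrite /= in_itv/= andbT => ey.
  have y0 : 0 < y by exact: lt_trans ey.
  have ys : `|s * y| = y by rewrite normrM s1 mul1r gtr0_norm.
  rewrite lee_fin /f ys powRN [leRHS]ger0_norm; last first.
    by rewrite mulr_ge0 ?invr_ge0 ?powR_ge0// addr_ge0// (le_trans _ (vM 0)).
  rewrite normrM [X in _ * X]ger0_norm ?invr_ge0 ?powR_ge0//.
  by rewrite ler_wpM2r ?invr_ge0 ?powR_ge0// (le_trans (ler_normB _ _))// lerD.
have fp (eps : R) : 0 < eps -> mu.-integrable `]eps, +oo[ (EFin \o f).
  move=> e0; have := fb 1 _ (normr1 _) e0.
  by rewrite (_ : (fun y => f (1 * y)) = f)//; apply/funext => y; rewrite mul1r.
have fn (eps : R) : 0 < eps -> mu.-integrable `]eps,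
  +oo[ (EFin \o (fun y => f (- y))).
  move=> e0; have := fb (-1) _ _ e0; rewrite normrN1 => /(_ erefl).
  by rewrite (_ : (fun y => f (-1 * y)) = (fun y => f (- y)))//;
    apply/funext => y; rewrite mulN1r.
have preN (eps : R) : -%R @^-1` `]-oo, (- eps)[%classic = `]eps,
  +oo[%classic :> set R.
  by apply/seteqP; split => y /=; rewrite !in_itv/= ?andbT ltrN2.
have Nf (eps : R) : 0 < eps -> mu.-integrable `]-oo, (- eps)[ (EFin \o f) /\
   \int[mu]_(y in `]-oo, (- eps)[) f y = \int[mu]_(y in `]eps, +oo[) f (- y).
  move=> e0; have := @integrable_opp `]-oo, (- eps)[ f (measurable_itv _) mf.
  by rewrite preN; apply; exact: fn.
have setE (eps : R) : [set y : R | eps < `|y|] = `]-oo,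
  (- eps)[%classic `|` `]eps, +oo[%classic.
  apply/seteqP; split => y /=; rewrite !in_itv/= ?andbT lter_normr.
    by move=> /orP[h|h]; [right|left; rewrite ltrNr].
  by move=> [h|h]; apply/orP; [right; rewrite ltrNr|left].
have dis (eps : R) : 0 < eps -> [disjoint `]-oo, (- eps)[%classic & `]eps,
  +oo[%classic].
  move=> e0; apply/disj_setPS => y /= []; rewrite !in_itv/= andbT => y1 y2.
  by have := lt_trans y2 y1; rewrite ltNge (le_trans _ (ltW e0))// oppr_le0 ltW.
have intN (eps : R) : 0 < eps ->
  mu.-integrable [set y : R | eps < `|y|] (EFin \o f).
  move=> e0; rewrite setE; have [i1 _] := Nf eps e0.
  apply/integrableP; split; first by apply/measurable_EFinP;
    exact: measurable_funTS.
  rewrite ge0_integral_setU//.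
  - apply: lte_add_pinfty; first by case/integrableP : i1.
    by have /integrableP[] := fp eps e0.
  - by apply: measurable_funTS; apply: measurableT_comp => //;
    exact/measurable_EFinP.
  - exact: dis.
split => //.
have <- : \int[mu]_(y in Rpos) second_difference_kernel a v x y = L by [].
have H := integrable_itvoy_cvg ik.
apply: cvg_trans H; apply: near_eq_cvg; near=> eps.
have e0 : 0 < eps by [].
have [i1 E] := Nf eps e0.
rewrite setE Rintegral_setU//; last 2 first.
- by rewrite -setE; exact: intN.
- exact: dis.
rewrite E -RintegralD//; [|exact: fn|exact: fp].
apply: eq_Rintegral => y; rewrite inE/= in_itv/= andbT => ey.
have y0 : 0 < y by exact: lt_trans ey.
by rewrite /f /second_difference_kernel normrN (gtr0_norm y0) powRN; ring.
Unshelve. all: by end_near. Qed.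

End principal_value.

(** * Linearity of principal value integrals *)

Section linearity.
Variable R : realType.
Local Notation mu := (@lebesgue_measure R).
Implicit Types (f g : R -> R).

Lemma is_pv_integral0 : is_pv_integral (fun _ : R => 0) 0.
Proof.
split=> [eps e0|]; first exact: integrable0.
rewrite (_ : (fun eps : R => _) = (fun=> 0)); first exact: cvg_cst.
by apply/funext => eps; rewrite /Rintegral integral0.
Qed.

Lemma is_pv_integral_linear f g (k l m : R) :
  is_pv_integral f l -> is_pv_integral g m ->
  is_pv_integral (fun y => f y + k * g y) (l + k * m).
Proof.
move=> [intf fl] [intg gm].
have mD (eps : R) : measurable [set y : R | eps < `|y|].
  have -> : [set y : R | eps < `|y|] = `]-oo, (- eps)[%classic `|` `]eps,
    +oo[%classic.
    apply/seteqP; split => y /=; rewrite !in_itv/= ?andbT lter_normr.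
      by move=> /orP[h|h]; [right|left; rewrite ltrNr].
    by move=> [h|h]; apply/orP; [right; rewrite ltrNr|left].
  exact: measurableU.
have intkg (eps : R) : 0 < eps ->
  mu.-integrable [set y | eps < `|y|] (EFin \o (fun y => k * g y)).
  by move=> e0; exact: (@integrableZl _ _ R mu _ (mD eps) k _ (intg eps e0)).
split=> [eps e0|].
  exact: (@integrableD _ _ R mu _ (mD eps) _ _ (intf eps e0) (intkg eps e0)).
have : \int[mu]_(y in [set y | eps < `|y|]) f y + k * \int[mu]_(y in [set y |
  eps < `|y|]) g y
   @[eps --> 0^'+] --> l + k * m.
  by apply: cvgD => //; apply: cvgM => //; exact: cvg_cst.
apply: cvg_trans; apply: near_eq_cvg; near=> eps.
have e0 : 0 < eps by [].
by rewrite (@RintegralD _ _ R mu _ _ _ (mD eps) (intf eps e0) (intkg eps e0))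
  (@RintegralZl _ _ R mu _ _ _ (mD eps) (intg eps e0)).
Unshelve. all: by end_near. Qed.

Lemma is_pv_integral_sum (n : nat) (F : nat -> R -> R) (c l : nat -> R) :
  (forall k, is_pv_integral (F k) (l k)) ->
  is_pv_integral (fun y => \sum_(k < n) c k * F k y) (\sum_(k < n) c k * l k).
Proof.
move=> Fl; elim: n => [|n IH].
  rewrite big_ord0 (_ : (fun y => _) = (fun=> 0)); first exact: is_pv_integral0.
  by apply/funext => y; rewrite big_ord0.
have := is_pv_integral_linear (c n) IH (Fl n).
rewrite big_ord_recr/= (_ : (fun y => _ + _) = (fun y => \sum_(k < n.+1) c k *
  F k y))//.
by apply/funext => y; rewrite big_ord_recr.
Qed.

End linearity.

(** * The multiplier rule for powers of [1 + i x] *)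

Section polar.
Variable R : realType.
Local Notation mu := (@lebesgue_measure R).
Local Notation Rpos := (`]0%R, +oo[%classic : set R).

(** The Gamma transform without its factor [Gamma s], so that exponents add and [s = 0] is
    allowed. *)
Definition polar_wave (s p q x : R) : R :=
  (1 + x ^+ 2) `^ (- (s / 2)) * wave p q (s * atan x).

Lemma wave_transform_polar (s p q x : R) : 0 < s ->
  wave_transform (Gamma_weight s) p q x = Gamma s * polar_wave s p q x.
Proof. by move=> s0; rewrite wave_transform_Gamma// /polar_wave mulrA. Qed.

(** Multiplying the weight of exponent [s] by [t ^ a] gives the weight of exponent [s + a], so the
    family is stable. The bound required for the truncations is [(1 + x ^ 2) ^ (- s / 2) <= 1]. *)
Lemma is_pv_integral_polar_wave (a s p q x : R) : 0 < a < 2 -> 0 < s ->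
  is_pv_integral (fun y => (polar_wave s p q x - polar_wave s p q (x + y)) /
    `|y| `^ (1 + a))
    ((fracLaplacian_const a)^-1 * (Gamma (s + a) / Gamma s * polar_wave (s + a)
      p q x)).
Proof.
move=> a02 s0; have a0 : 0 < a by case/andP: a02.
have sa0 : 0 < s + a by rewrite addr_gt0.
have iw := integrable_Gamma_weight s0.
have mw : measurable_fun setT (@Gamma_weight R s).
  apply: measurable_funM; first exact: measurable_powR.
  by apply: measurableT_comp.
have Ew : {in Rpos, Gamma_weight (s + a) =1 (fun t => t `^ a * Gamma_weight s
  t)}.
  move=> t; rewrite inE/= in_itv/= andbT => t0.
  rewrite /Gamma_weight mulrA -powRD ?(gt_eqF t0) ?implybT//.
  by congr (_ `^ _ * _); ring.
have iaw : mu.-integrable Rpos (EFin \o (fun t => t `^ a * Gamma_weight s t)).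
  apply: (@eq_integrable _ _ R mu Rpos (measurable_itv _) _ _ _
    (integrable_Gamma_weight sa0)).
  by move=> t /Ew /= ->.
have [ik ek] := second_difference_wave_transform a02 mw iw iaw p q x.
have mu0 : measurable_fun setT (wave_transform (Gamma_weight s) p q).
  apply: continuous_measurable_fun => y; apply: is_derive_continuous.
  exact: is_derive_wave_transform_Gamma.
have ub y : `|wave_transform (Gamma_weight s) p q y| <= Gamma s * (`|p| + `|q|).
  rewrite wave_transform_Gamma// normrM ler_pM ?norm_wave_le// normrM.
  rewrite gtr0_norm ?Gamma_gt0// ler_piMr ?(ltW (Gamma_gt0 s0))//.
  rewrite ger0_norm ?powR_ge0// powRN invf_le1 ?powR_gt0 ?ltr_pwDl ?sqr_ge0//.
  rewrite -{1}(powRr0 (1 + y ^+ 2)) ler_powR ?divr_ge0 ?(ltW s0)//.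
  by rewrite lerDl sqr_ge0.
have pv := is_pv_integral_symmetric a02 mu0 ub ik ek.
(* Adding to the zero function is used as scaling, to remove the factor [Gamma s]. *)
have := is_pv_integral_linear (Gamma s)^-1 (@is_pv_integral0 R) pv.
have G0 : Gamma s != 0 by rewrite gt_eqF// Gamma_gt0.
rewrite add0r (_ : (fun y => _ + _) = (fun y =>
   (polar_wave s p q x - polar_wave s p q (x + y)) / `|y| `^ (1 + a)));
     last first.
  by apply/funext => y; rewrite !wave_transform_polar// add0r mulrA -mulrBr
    mulKf.
have -> : wave_transform (fun t => t `^ a * Gamma_weight s t) p q x =
    wave_transform (Gamma_weight (s + a)) p q x.
  by apply: eq_Rintegral => t /Ew ->.
rewrite wave_transform_polar//; congr is_pv_integral.
by field; rewrite G0 gt_eqF// fracLaplacian_const_gt0.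
Qed.

End polar.

(** * Powers of 1 + i x and the closed form *)

Section complex_polar.
Variable R : realType.
Implicit Types (s t x : R) (n k : nat).

Lemma Re_sum n (c : nat -> R) (z : nat -> R[i]) :
  complex.Re (\sum_(k < n) (c k)%:C%C * z k) = \sum_(k < n) c k * complex.Re (z
    k).
Proof.
elim: n => [|n IH]; first by rewrite !big_ord0.
rewrite !big_ord_recr/= -IH; case: (\sum_(_ < _) _) => u v;
  case: (z n) => u' v' /=.
by rewrite mul0r subr0.
Qed.

Lemma Im_sum n (c : nat -> R) (z : nat -> R[i]) :
  complex.Im (\sum_(k < n) (c k)%:C%C * z k) = \sum_(k < n) c k * complex.Im (z
    k).
Proof.
elim: n => [|n IH]; first by rewrite !big_ord0.
rewrite !big_ord_recr/= -IH; case: (\sum_(_ < _) _) => u v;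
  case: (z n) => u' v' /=.
by rewrite mul0r addr0.
Qed.

(* [(1 + i x) ^ (- s)]; [polar_wave s] gives its real and imaginary parts. *)
Definition cpolar s x : R[i] :=
  (polar_wave s 1 0 x +i* polar_wave s 0 (-1) x)%C.

Lemma cpolarD s t x : cpolar (s + t) x = cpolar s x * cpolar t x.
Proof.
have x1 : 0 < 1 + x ^+ 2 by rewrite ltr_pwDl// sqr_ge0.
rewrite /cpolar /polar_wave /wave (mulrDl s t (atan x)) cosD sinD.
have -> : - ((s + t) / 2) = - (s / 2) + - (t / 2) by ring.
rewrite powRD ?(gt_eqF x1) ?implybT//.
by apply/eqP; rewrite eq_complex /=; apply/andP; split; apply/eqP; ring.
Qed.

Lemma cpolar0 x : cpolar 0 x = 1.
Proof.
rewrite /cpolar /polar_wave /wave !mul0r oppr0 powRr0 cos0 sin0.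
by apply/eqP; rewrite eq_complex /=; apply/andP; split; apply/eqP; ring.
Qed.

Lemma one_plus_ix_neq0 x : 1 + 'i%C * x%:C%C != 0.
Proof.
rewrite eq_complex /= negb_and; apply/orP; left.
by rewrite mul0r mulr0 subrr addr0 oner_eq0.
Qed.

(** Ties the polar form to the field inverse, through [cos (atan x) = (1 + x ^ 2) ^ (- 1 / 2)] and
    [sin (atan x) = x * cos (atan x)]. *)
Lemma cpolar1 x : cpolar 1 x = (1 + 'i%C * x%:C%C)^-1.
Proof.
have x1 : 0 < 1 + x ^+ 2 by rewrite ltr_pwDl// sqr_ge0.
apply: (mulIf (one_plus_ix_neq0 x)); rewrite mulVf ?one_plus_ix_neq0//.
have c0 : cos (atan x) != 0 by rewrite cos_atan invr_eq0 sqrtr_eq0 -ltNge.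
have sE : sin (atan x) = x * cos (atan x).
  by rewrite -{2}(atanK x) /tan mulfVK.
rewrite /cpolar /polar_wave /wave !mul1r sE cos_atan powRN powR12_sqrt ?(ltW
  x1)//.
have qE : (Num.sqrt (1 + x ^+ 2))^-1 * (Num.sqrt (1 + x ^+ 2))^-1 = (1 + x ^+
  2)^-1.
  by rewrite -invfM -expr2 sqr_sqrtr// ltW.
set q := (Num.sqrt _)^-1 in qE *.
apply/eqP; rewrite eq_complex /=; apply/andP; split; apply/eqP; last by ring.
transitivity (q * q * (1 + x ^+ 2)); first by ring.
by rewrite qE mulVf// gt_eqF.
Qed.

Lemma cpolar_nat k x : cpolar k%:R x = cpolar 1 x ^+ k.
Proof.
elim: k => [|k IH]; first by rewrite cpolar0 expr0.
by rewrite -[in LHS]addn1 natrD cpolarD IH exprSr.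
Qed.

(** Coefficient of [(1 + i x) ^ (- (k + 1))] in [(1 - 2 / (1 + i x)) ^ n]. The index is shifted
    because the constant term is annihilated by the operator. *)
Definition binom_coef n k : R := 'C(n, k.+1)%:R * (-2) ^+ k.+1.

Lemma lambda_natE n x : lambda n%:Z x = (1 - 2 * cpolar 1 x) ^+ n.
Proof.
have h := one_plus_ix_neq0 x.
rewrite /lambda; have <- : ('i%C * x%:C%C - 1) / ('i%C * x%:C%C + 1) = 1 - 2 *
  cpolar 1 x :> R[i].
  by rewrite cpolar1; move: h; set j := (_ * _ : R[i]) => h; field.
by [].
Qed.

Lemma lambda_sum n x : lambda n%:Z x =
  1 + \sum_(k < n) (binom_coef n k)%:C%C * cpolar k.+1%:R x.
Proof.
rewrite lambda_natE exprDn big_ord_recl bin0 mulr1n expr0 mulr1 expr1n;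
  congr (_ + _).
apply: eq_bigr => k _; rewrite lift0 expr1n mul1r -mulNr exprMn -cpolar_nat
  /binom_coef.
rewrite rmorphM rmorph_nat rmorphXn rmorphN rmorph_nat.
by rewrite -mulr_natl mulrA.
Qed.

(** For real [x] the base has modulus one, so its inverse is its conjugate. *)
Lemma lambdaN n x : lambda (- n%:Z) x = (lambda n%:Z x)^*%C.
Proof.
have h := one_plus_ix_neq0 x.
have hN : 1 - 'i%C * x%:C%C != 0.
  rewrite eq_complex /= negb_and; apply/orP; left.
  by rewrite mul0r mulr0 subrr subr0 oner_eq0.
have conjh : (1 + 'i%C * x%:C%C)^*%C = 1 - 'i%C * x%:C%C.
  by apply/eqP; rewrite eq_complex /=; apply/andP; split; apply/eqP; ring.
rewrite lambda_natE rmorphXn /lambda -exprz_inv -exprnP; congr (_ ^+ _).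
rewrite cpolar1 rmorphB rmorph1 rmorphM rmorph_nat fmorphV [X in 2 / X]conjh.
move: h hN; set j := (_ * _ : R[i]) => h hN.
have jN : j - 1 != 0 by rewrite -oppr_eq0 opprB.
by field; rewrite hN jN addrC h.
Qed.

Lemma CH_evenE n x : CH_even n x = (complex.Re (lambda n%:Z x))%:C%C.
Proof. by rewrite /CH_even lambdaN ReJ_add. Qed.

Lemma SH_oddE n x : SH_odd n x = (complex.Im (lambda n.+1%:Z x))%:C%C.
Proof.
have i0 : 'i%C != 0 :> R[i] by rewrite eq_complex /= oner_eq0 andbF.
by rewrite /SH_odd lambdaN subcJ; move: ('i)%C i0 => j j0; field.
Qed.

Lemma Re_lambda n x : complex.Re (lambda n%:Z x) =
  1 + \sum_(k < n) binom_coef n k * polar_wave k.+1%:R 1 0 x.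
Proof.
rewrite lambda_sum -(Re_sum n (binom_coef n) (fun k => cpolar k.+1%:R x)).
by case: (\sum_(_ < _) _).
Qed.

Lemma Im_lambda n x : complex.Im (lambda n%:Z x) =
  \sum_(k < n) binom_coef n k * polar_wave k.+1%:R 0 (-1) x.
Proof.
rewrite lambda_sum -(Im_sum n (binom_coef n) (fun k => cpolar k.+1%:R x)).
by case: (\sum_(_ < _) _) => ? ?; rewrite /= add0r.
Qed.

(** The multiplier rule applied term by term to the expansion of [lambda n]. *)
Definition fracLaplacian_lambda a n x : R[i] :=
  \sum_(k < n) (binom_coef n k * (Gamma (k.+1%:R + a) / Gamma k.+1%:R))%:C%C *
     cpolar (k.+1%:R + a) x.

Lemma is_fracLaplacian_real a (u : R -> R) x l : 0 < a < 2 ->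
  is_pv_integral (fun y => (u x - u (x + y)) / `|y| `^ (1 + a))
    ((fracLaplacian_const a)^-1 * l) ->
  is_fracLaplacian a (fun y => (u y)%:C%C) x l%:C%C.
Proof.
move=> a02 h; have c0 := fracLaplacian_const_gt0 a02.
exists ((fracLaplacian_const a)^-1 * l)%:C%C; split; last first.
  by rewrite -rmorphM mulVKf// gt_eqF.
have E y : ((u x)%:C - (u (x + y))%:C)%C / (`|y| `^ (1 + a))%:C%C =
   ((u x - u (x + y)) / `|y| `^ (1 + a))%:C%C.
  by rewrite rmorphM rmorphB fmorphV.
split.
  by under eq_fun do rewrite E.
rewrite (_ : (fun y => _) = (fun=> 0)); first exact: is_pv_integral0.
by apply/funext => y; rewrite E.
Qed.

Lemma is_pv_integral_polar_sum a n (c : nat -> R) (d p q x : R) : 0 < a < 2 ->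
  let u z := d + \sum_(k < n) c k * polar_wave k.+1%:R p q z in
  is_pv_integral (fun y => (u x - u (x + y)) / `|y| `^ (1 + a))
   ((fracLaplacian_const a)^-1 *
     \sum_(k < n) c k * (Gamma (k.+1%:R + a) / Gamma k.+1%:R) * polar_wave
       (k.+1%:R + a) p q x).
Proof.
move=> a02 u.
have pv k := @is_pv_integral_polar_wave R a k.+1%:R p q x a02 (ltr0Sn _ k).
have := is_pv_integral_sum n c pv.
rewrite (_ : (fun y => \sum_(k < n) _) = (fun y => (u x - u (x + y)) / `|y| `^
  (1 + a))); last first.
  apply/funext => y; rewrite /u opprD addrACA subrr add0r -sumrB mulr_suml.
  by apply: eq_bigr => k _; rewrite mulrA mulrBr.
congr is_pv_integral; rewrite mulr_sumr; apply: eq_bigr => k _; ring.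
Qed.

Lemma is_fracLaplacian_CH a n x : 0 < a < 2 ->
  is_fracLaplacian a (@CH_even R n) x (complex.Re (fracLaplacian_lambda a n
    x))%:C%C.
Proof.
move=> a02; rewrite (_ : @CH_even R n = fun y => (1 + \sum_(k < n) binom_coef n
  k * polar_wave k.+1%:R 1 0 y)%:C%C).
  apply: is_fracLaplacian_real => //.
  have := @is_pv_integral_polar_sum a n (binom_coef n) 1 1 0 x a02.
  by rewrite /fracLaplacian_lambda (Re_sum n (fun k => binom_coef n k * (Gamma
    (k.+1%:R + a) / Gamma k.+1%:R))
   (fun k => cpolar (k.+1%:R + a) x)).
by apply/funext => y; rewrite CH_evenE Re_lambda.
Qed.

Lemma is_fracLaplacian_SH a n x : 0 < a < 2 ->
  is_fracLaplacian a (@SH_odd R n) x (complex.Im (fracLaplacian_lambda a n.+1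
    x))%:C%C.
Proof.
move=> a02; rewrite (_ : @SH_odd R n = fun y => (0 + \sum_(k < n.+1) binom_coef
  n.+1 k * polar_wave k.+1%:R 0 (-1) y)%:C%C).
  apply: is_fracLaplacian_real => //.
  have := @is_pv_integral_polar_sum a n.+1 (binom_coef n.+1) 0 0 (-1) x a02.
  by rewrite /fracLaplacian_lambda (Im_sum n.+1 (fun k => binom_coef n.+1 k *
    (Gamma (k.+1%:R + a) / Gamma k.+1%:R))
   (fun k => cpolar (k.+1%:R + a) x)).
by apply/funext => y; rewrite SH_oddE Im_lambda add0r.
Qed.

End complex_polar.

(** * Finite sums and a binomial identity *)

Lemma sum_ord_vanish (V : zmodType) (F : nat -> V) (a b : nat) :
  (forall m, (a <= m)%N -> F m = 0) -> (a <= b)%N ->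
  \sum_(m < b) F m = \sum_(m < a) F m.
Proof.
move=> F0 ab; rewrite -!(big_mkord xpredT) (@big_cat_nat _ _ _ a)//=.
by rewrite addrC big_nat big1 ?add0r// => m /andP[am _]; exact: F0.
Qed.

(** Both sums are padded to the same number of terms. For [N = 0], truncated subtraction leaves the
    odd term [F 1], which vanishes by hypothesis. *)
Lemma sum_even_odd (V : zmodType) (F : nat -> V) (N : nat) :
  (forall m, (N < m)%N -> F m = 0) ->
  \sum_(m < N.+1) F m =
  \sum_(l < (N./2).+1) F (2 * l)%N + \sum_(l < ((N - 1)./2).+1) F (2 * l + 1)%N.
Proof.
move=> F0.
have E K : \sum_(m < (2 * K)%N) F m = \sum_(l < K) F (2 * l)%N + \sum_(l < K) F
  (2 * l + 1)%N.
  elim: K => [|K IH]; first by rewrite !big_ord0 addr0.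
  have -> : (2 * K.+1 = (2 * K).+2)%N by rewrite mulnS.
  by rewrite !big_ord_recr/= IH addn1; rewrite -!addrA; congr (_ + _);
    rewrite addrCA.
have N2 : (N < 2 * (N./2).+1)%N by lia.
rewrite -(@sum_ord_vanish _ F _ (2 * (N./2).+1)%N)// E; congr (_ + _).
apply: (@sum_ord_vanish _ (fun l => F (2 * l + 1)%N)); last by lia.
by move=> l Nl; apply: F0; lia.
Qed.

(* Coefficient of ['X^k] in [(y + z (1 + 'X)) ^ N = ((y + z) + z 'X) ^ N]. *)
Lemma sum_bin_bin (F : comNzRingType) (y z : F) (N k : nat) :
  \sum_(m < N.+1) 'C(N, m)%:R * 'C(m, k)%:R * (y ^+ (N - m) * z ^+ m) =
  'C(N, k)%:R * ((y + z) ^+ (N - k) * z ^+ k).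
Proof.
have coefD1X m : ((1 + 'X) ^+ m : {poly F})`_k = 'C(m, k)%:R.
  rewrite exprDn coef_sum.
  under eq_bigr do rewrite expr1n mul1r coefMn coefXn mulrb.
  have [km|mk] := ltnP k m.+1.
    rewrite (bigD1 (Ordinal km))//= eqxx big1 ?addr0// => i ik.
    rewrite ifN ?mul0rn// eq_sym; apply: contra ik => /eqP ik.
    by apply/eqP/val_inj.
  rewrite bin_small// big1// => i _; rewrite ifN ?mul0rn//.
  by rewrite gtn_eqF// (leq_trans (ltn_ord i)).
have := congr1 (fun p : {poly F} => p`_k) (exprDn (y%:P) (z%:P * (1 + 'X)) N).
rewrite coef_sum => E; transitivity ((y%:P + z%:P * (1 + 'X)) ^+ N)`_k.
  rewrite E; apply: eq_bigr => m _.
  rewrite coefMn exprMn -!polyC_exp !coefCM coefD1X -[RHS]mulr_natl; ring.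
have -> : y%:P + z%:P * (1 + 'X) = (y + z)%:P + z%:P * 'X by rewrite polyCD
  mulrDr mulr1 addrA.
rewrite exprDn coef_sum.
have cE (m : 'I_N.+1) : (((y + z)%:P ^+ (N - m) * (z%:P * 'X) ^+ m) *+ 'C(N,
  m))`_k =
    if k == m then 'C(N, k)%:R * ((y + z) ^+ (N - k) * z ^+ k) else 0.
  rewrite coefMn exprMn -!polyC_exp !coefCM coefXn.
  case: eqP => [->|_]; last by rewrite !mulr0 mul0rn.
  by rewrite mulr1 mulr_natl.
under eq_bigr do rewrite cE.
have [kN|Nk] := ltnP k N.+1.
  rewrite (bigD1 (Ordinal kN))//= eqxx big1 ?addr0// => i ik.
  rewrite ifN// eq_sym; apply: contra ik => /eqP ik.
  by apply/eqP/val_inj.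
rewrite bin_small// mul0r big1// => i _; rewrite ifN//.
by rewrite gtn_eqF// (leq_trans (ltn_ord i)).
Qed.

(** * Terminating hypergeometric sums and values of Gamma *)

Section hypergeometric.
Variable R : realType.
Implicit Types (a x b : R).

Lemma pochhammerS b k : pochhammer b k.+1 = pochhammer b k * (b + k%:R).
Proof. by rewrite /pochhammer big_ord_recr. Qed.

Lemma pochhammerN (m k : nat) : pochhammer (- m%:R : R) k = (-1) ^+ k * (m ^_
  k)%:R.
Proof.
elim: k => [|k IH]; first by rewrite /pochhammer big_ord0 expr0 mul1r.
rewrite pochhammerS IH ffactnSr natrM exprSr.
have [km|mk] := leqP k m; first by rewrite natrB//; ring.
by rewrite ffact_small// !(mul0r, mulr0).
Qed.

Lemma pochhammer2 (k : nat) : pochhammer (2 : R) k = k.+1`!%:R.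
Proof.
elim: k => [|k IH]; first by rewrite /pochhammer big_ord0.
by rewrite pochhammerS IH [in RHS]factS natrM -natrD mulrC.
Qed.

(** The Pochhammer symbol of [- m] divided by [k!] is [(-1) ^ k] times a binomial coefficient, and
    that of 2 is [(k + 1)!]. Hence the hypergeometric value at 2 is the binomial transform of this
    sequence. *)
Definition hyp_coef a (k : nat) : R :=
  (-2) ^+ k * pochhammer (1 + a) k / k.+1`!%:R.

(** The common range [N] for all [m <= N], filled up with vanishing binomials, allows the summations
    over [m] and [k] to be exchanged. *)
Lemma hyp2F1_binomial a (m N : nat) : (m <= N)%N ->
  hyp2F1 (- m%:R) (1 + a) 2 2 = \sum_(k < N.+1) 'C(m, k)%:R * hyp_coef a k.
Proof.
move=> mN; rewrite hyp2F1_poly big_mkord.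
rewrite (@sum_ord_vanish _ (fun k => 'C(m, k)%:R * hyp_coef a k) m.+1 N.+1)//;
  last first.
  by move=> k mk; rewrite bin_small// mul0r.
apply: eq_bigr => k _.
rewrite /hyp2F1_term /hyp_coef pochhammerN pochhammer2 -bin_ffact natrM.
have f0 : k`!%:R != 0 :> R by rewrite pnatr_eq0 -lt0n fact_gt0.
have f1 : k.+1`!%:R != 0 :> R by rewrite pnatr_eq0 -lt0n fact_gt0.
have -> : (-2) ^+ k = (-1) ^+ k * 2 ^+ k :> R by rewrite -exprMn mulN1r.
by field; rewrite f0 f1.
Qed.

Lemma Gamma1 : Gamma (1 : R) = 1.
Proof.
have dE (t : R) : is_derive t 1 (fun t => - expR (- t)) (expR (- t)).
  have d := @is_derive_chain _ expR -%R t _ _ (is_derive_expR _)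
    (is_deriveN (is_derive_id t 1)).
  by apply: (is_derive_eq (is_deriveN d)); rewrite mulrN1 opprK.
have -> : Gamma (1 : R) = fine (\int[@lebesgue_measure R]_(t in `]0%R,
  +oo[) (expR (- t))%:E).
  rewrite /Gamma /Rintegral; congr fine; apply: eq_integral => t;
    rewrite inE/= in_itv/= andbT => t0.
  by rewrite subrr powRr0 mul1r.
suff -> : (\int[@lebesgue_measure R]_(t in `]0%R,
  +oo[) (expR (- t))%:E = (0 - (-1))%:E)%E.
  by rewrite /= sub0r opprK.
apply: (@ge0_FTC0y R (fun t => expR (- t)) (fun t => - expR (- t)) (-1) 0).
- by move=> t _; exact: expR_ge0.
- move=> t _; apply: (@continuous_comp _ _ _ (fun x : R => - x) expR);
  last exact: continuous_expR.
  exact: opp_continuous.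
- have := cvg_at_right_filter (is_derive_continuous (dE 0)).
  by rewrite oppr0 expR0.
- by rewrite -oppr0; apply: cvgN; exact: cvgr_expR.
Qed.

Lemma Gamma_nat (k : nat) : Gamma (k.+1%:R : R) = k`!%:R.
Proof.
elim: k => [|k IH]; first exact: Gamma1.
by rewrite -[in LHS]addn1 natrD GammaS// IH factS natrM.
Qed.

Lemma Gamma_pochhammer a (k : nat) : 0 < a ->
  Gamma (k.+1%:R + a) = Gamma (1 + a) * pochhammer (1 + a) k.
Proof.
move=> a0; elim: k => [|k IH]; first by rewrite /pochhammer big_ord0 mulr1.
rewrite -[in LHS]addn1 natrD addrAC GammaS ?addr_gt0// IH pochhammerS.
by rewrite -[in LHS]addn1 natrD; ring.
Qed.

End hypergeometric.

(** * The closed form of the sum *)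

Section closed_form.
Variable R : realType.
Implicit Types (a x t : R).

(** After exchanging the sums, the inner one is [sum_bin_bin]. It is used with [y = x] and
    [z = - i]. *)
Lemma sum_bin_hyp (F : comNzRingType) (c : nat -> F) (y z : F) (N : nat) :
  \sum_(m < N.+1) 'C(N, m)%:R * (y ^+ (N - m) * z ^+ m) *
     (\sum_(k < N.+1) 'C(m, k)%:R * c k) =
  \sum_(k < N.+1) 'C(N, k)%:R * c k * ((y + z) ^+ (N - k) * z ^+ k).
Proof.
under eq_bigr do rewrite mulr_sumr.
rewrite exchange_big; apply: eq_bigr => k _ /=.
rewrite mulrAC -sum_bin_bin mulr_suml; apply: eq_bigr => m _; ring.
Qed.

Lemma cis_pihalf (n : nat) t :
  (cos (n%:R * (pi / 2) + t) +i* sin (n%:R * (pi / 2) + t))%C =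
  'i%C ^+ n * (cos t +i* sin t)%C.
Proof.
elim: n => [|n IH]; first by rewrite expr0 mul1r mul0r add0r.
have -> : n.+1%:R * (pi / 2) + t = n%:R * (pi / 2) + t + pi / 2.
  by rewrite -addn1 natrD mulrDl mul1r addrAC.
rewrite cosDpihalf sinDpihalf exprS -mulrA -IH.
by apply/eqP; rewrite eq_complex /=; apply/andP; split; apply/eqP; ring.
Qed.

(** Since [arccot x = pi / 2 - atan x], the angle equals [n * pi / 2 - (n + a) * atan x]: the shift
    [- pi * a / 2] cancels the fractional part of the rotation and leaves the integer power
    [i ^ n]. *)
Lemma cis_arccot a x (n : nat) :
  ((1 + x ^+ 2) `^ (- ((n%:R + a) / 2)))%:C%C *
    (cos ((n%:R + a) * arccot x - pi * a / 2) +i*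
     sin ((n%:R + a) * arccot x - pi * a / 2))%C =
  'i%C ^+ n * cpolar (n%:R + a) x.
Proof.
have -> : (n%:R + a) * arccot x - pi * a / 2 = n%:R * (pi / 2) + - ((n%:R + a)
  * atan x).
  by rewrite arccotE; field.
rewrite cis_pihalf mulrCA; congr (_ * _).
rewrite cosN sinN /cpolar /polar_wave /wave.
by apply/eqP; rewrite eq_complex /=; apply/andP; split; apply/eqP; ring.
Qed.

(** [N] stands for [n - 1] in the formula for CH and for [n] in that for SH. *)
Definition even_sum a x (N : nat) : R :=
  \sum_(0 <= l < (N./2).+1) (-1) ^+ l * 'C(N, 2 * l)%:R * x ^+ (N - 2 * l)
    * hyp2F1 (- (2 * l)%:R) (1 + a) 2 2.

Definition odd_sum a x (N : nat) : R :=
  \sum_(0 <= l < ((N - 1)./2).+1) (-1) ^+ l * 'C(N,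
    2 * l + 1)%:R * x ^+ (N - 1 - 2 * l)
    * hyp2F1 (- (2 * l)%:R - 1) (1 + a) 2 2.

(** [(- i) ^ m] is [(-1) ^ l] for [m = 2 l] and [- i * (-1) ^ l] for [m = 2 l + 1], so the two real
    sums are the components of a single complex one. *)
Lemma even_odd_sum a x (N : nat) :
  (even_sum a x N -i* odd_sum a x N)%C =
  \sum_(m < N.+1) 'C(N, m)%:R * (x%:C%C ^+ (N - m) * (- 'i%C) ^+ m) *
     (hyp2F1 (- m%:R) (1 + a) 2 2)%:C%C.
Proof.
pose F (m : nat) : R[i] := 'C(N, m)%:R * (x%:C%C ^+ (N - m) * (- 'i%C) ^+ m) *
     (hyp2F1 (- m%:R) (1 + a) 2 2)%:C%C.
rewrite (@sum_even_odd _ F); last by move=> m Nm; rewrite /F bin_small// !mul0r.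
have i2 : (- 'i%C) ^+ 2 = -1 :> R[i] by rewrite sqrrN sqr_i.
have -> : \sum_(l < (N./2).+1) F (2 * l)%N = (even_sum a x N)%:C%C.
  rewrite /even_sum big_mkord rmorph_sum; apply: eq_bigr => l _.
  by rewrite !rmorphM rmorphXn rmorphN rmorph1 rmorph_nat rmorphXn /F exprM i2;
    ring.
have -> : \sum_(l < ((N - 1)./2).+1) F (2 * l + 1)%N = - 'i%C * (odd_sum a x
  N)%:C%C.
  rewrite /odd_sum big_mkord rmorph_sum mulr_sumr; apply: eq_bigr => l _.
  rewrite !rmorphM rmorphXn rmorphN rmorph1 rmorph_nat rmorphXn /F exprD exprM
    i2 expr1.
  have -> : (N - (2 * l + 1) = N - 1 - 2 * l)%N by lia.
  have -> : - (2 * l + 1)%:R = - (2 * l)%:R - 1 :> R by rewrite natrD opprD.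
  by ring.
by apply/eqP; rewrite eq_complex /=; apply/andP; split; apply/eqP; ring.
Qed.

(** Both sides are sums over [k] of multiples of [cpolar (k + 1 + a) x], compared term by term: on
    the right, [(1 + i x) ^ (N - k)] lowers the exponent [N + 1 + a] to [k + 1 + a]. *)
Lemma fracLaplacian_lambda_closed a x (N : nat) : 0 < a ->
  fracLaplacian_lambda a N.+1 x =
  (2 * N.+1%:R * Gamma (1 + a) * (1 + x ^+ 2) `^ (- ((N.+1%:R + a) / 2)))%:C%C
    * 'i%C *
  (cos ((N.+1%:R + a) * arccot x - pi * a / 2) +i*
   sin ((N.+1%:R + a) * arccot x - pi * a / 2))%C *
  (even_sum a x N -i* odd_sum a x N)%C.
Proof.
move=> a0; set cA := (cos _ +i* _)%C.
have z0 : cpolar 1 x != 0 by rewrite cpolar1 invr_eq0 one_plus_ix_neq0.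
have -> : (even_sum a x N -i* odd_sum a x N)%C =
    \sum_(k < N.+1) 'C(N, k)%:R * (hyp_coef a k)%:C%C *
      ((- 'i%C) ^+ N * (cpolar 1 x)^-1 ^+ (N - k)).
  rewrite even_odd_sum.
  transitivity (\sum_(m < N.+1) 'C(N,
    m)%:R * (x%:C%C ^+ (N - m) * (- 'i%C) ^+ m) *
      (\sum_(k < N.+1) 'C(m, k)%:R * (hyp_coef a k)%:C%C)).
    apply: eq_bigr => m _; congr (_ * _).
    rewrite (@hyp2F1_binomial _ _ m N) -1?ltnS// rmorph_sum.
    by apply: eq_bigr => k _; rewrite rmorphM rmorph_nat.
  rewrite (sum_bin_hyp (fun k => (hyp_coef a k)%:C%C)); apply: eq_bigr => k _;
    congr (_ * _).
  have -> : x%:C%C + - 'i%C = - 'i%C * (cpolar 1 x)^-1.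
    rewrite cpolar1 invrK.
    by apply/eqP; rewrite eq_complex /=; apply/andP; split; apply/eqP; ring.
  by rewrite exprMn mulrAC -exprD subnK// -ltnS.
(* The three sources of [i] combine: the prefactor, the rotation by arccot, and
   [x - i = - i * (1 + i x)]. *)
have iN : 'i%C * 'i%C ^+ N.+1 * (- 'i%C) ^+ N = -1 :> R[i].
  by rewrite exprS mulrA -expr2 sqr_i -mulrA -exprMn mulrN -expr2 sqr_i opprK
    expr1n mulr1.
rewrite rmorphM -[X in _ = X * _]mulrA [_ * cA]mulrC.
have cAE := cis_arccot a x N.+1; rewrite -/cA in cAE.
transitivity ((2 * N.+1%:R * Gamma (1 + a))%:C%C * 'i%C * ('i%C ^+ N.+1 *
  cpolar (N.+1%:R + a) x) *
  \sum_(k < N.+1) 'C(N, k)%:R * (hyp_coef a k)%:C%C * ((- 'i%C) ^+ N * (cpolar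
    1 x)^-1 ^+ (N - k))); last first.
  by rewrite -cAE; ring.
rewrite mulr_sumr /fracLaplacian_lambda; apply: eq_bigr => k _.
have kN : (k <= N)%N by rewrite -ltnS.
have -> : cpolar (N.+1%:R + a) x = cpolar (k.+1%:R + a) x * cpolar 1 x ^+ (N -
  k).
  rewrite -cpolar_nat -cpolarD natrB//.
  by congr (cpolar _ x); rewrite -!(natr1 _); ring.
rewrite exprVn.
set w := cpolar (_ + a) x;
  have zk : cpolar 1 x ^+ (N - k) != 0 by rewrite expf_neq0.
transitivity ((2 * N.+1%:R * Gamma (1 + a))%:C%C * ('i%C * 'i%C ^+ N.+1 * (-
  'i%C) ^+ N) *
   'C(N, k)%:R * (hyp_coef a k)%:C%C * w); last first.
  by move: zk; set v := _ ^+ (N - k) => zk; field.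
rewrite iN; congr (_ * _).
rewrite /binom_coef Gamma_pochhammer// Gamma_nat /hyp_coef.
rewrite mulrN1 mulNr -(rmorph_nat (real_complex R)) mulNr -!rmorphM -rmorphN;
  congr (_%:C)%C.
have f0 : k`!%:R != 0 :> R by rewrite pnatr_eq0 -lt0n fact_gt0.
have k0 : k.+1%:R != 0 :> R by rewrite pnatr_eq0.
(* The absorption identity produces the factor [N + 1] and turns [k!] into [(k + 1)!]. *)
have bE : k.+1%:R * 'C(N.+1, k.+1)%:R = N.+1%:R * 'C(N, k)%:R :> R.
  by rewrite -!natrM; congr (_%:R); have := mul_bin_diag N.+1 k.
rewrite factS natrM exprS.
have -> : 'C(N.+1, k.+1)%:R = N.+1%:R * 'C(N,
  k)%:R / k.+1%:R :> R by rewrite -bE mulrC mulKf.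
by field; rewrite f0 nat1r pnatr_eq0.
Qed.

End closed_form.

(** With [C], [S] the cosine and sine and [E], [O] the two sums, [i (C + i S) (E - i O)] has real
    part [C O - S E] and imaginary part [C E + S O]. *)
Lemma Re_lambda_closed (R : realType) (a x : R) (N : nat) : 0 < a ->
  complex.Re (fracLaplacian_lambda a N.+1 x) =
  - (2 * N.+1%:R * Gamma (1 + a) / (1 + x ^+ 2) `^ ((N.+1%:R + a) / 2))
    * sin ((N.+1%:R + a) * arccot x - pi * a / 2) * even_sum a x N
  + 2 * N.+1%:R * Gamma (1 + a) / (1 + x ^+ 2) `^ ((N.+1%:R + a) / 2)
    * cos ((N.+1%:R + a) * arccot x - pi * a / 2) * odd_sum a x N.
Proof. by move=> a0; rewrite fracLaplacian_lambda_closed// powRN /=; ring. Qed.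

Lemma Im_lambda_closed (R : realType) (a x : R) (N : nat) : 0 < a ->
  complex.Im (fracLaplacian_lambda a N.+1 x) =
  2 * N.+1%:R * Gamma (1 + a) / (1 + x ^+ 2) `^ ((N.+1%:R + a) / 2)
    * cos ((N.+1%:R + a) * arccot x - pi * a / 2) * even_sum a x N
  + 2 * N.+1%:R * Gamma (1 + a) / (1 + x ^+ 2) `^ ((N.+1%:R + a) / 2)
    * sin ((N.+1%:R + a) * arccot x - pi * a / 2) * odd_sum a x N.
Proof. by move=> a0; rewrite fracLaplacian_lambda_closed// powRN /=; ring. Qed.

(** This and the next evaluation make the separate formulas for CH_2 and SH_1 the case [N = 0] of
    the general one. *)
Lemma even_sum0 (R : realType) (a x : R) : even_sum a x 0 = 1.
Proof.
rewrite /even_sum big_nat1 muln0 (hyp2F1_binomial a (leqnn 0)) big_ord_recl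
  big_ord0.
by rewrite bin0 /hyp_coef /pochhammer big_ord0 !expr0 !mul1r invr1 addr0.
Qed.

(** Truncated subtraction leaves the single term [l = 0], with binomial coefficient
    ['C(0, 1) = 0]. *)
Lemma odd_sum0 (R : realType) (a x : R) : odd_sum a x 0 = 0.
Proof. by rewrite /odd_sum big_nat1 bin_small// mulr0 !mul0r. Qed.

Theorem proposition3p2 (R : realType) (alpha : R) (halpha : 0 < alpha < 2)
    (x : R) :
  (is_fracLaplacian alpha (@CH_even R 0) x 0 /\
   is_fracLaplacian alpha (@CH_even R 1) x
     (- (2 * Gamma (1 + alpha) / (1 + x ^+ 2) `^ ((1 + alpha) / 2))
      * sin ((1 + alpha) * arccot x - pi * alpha / 2))%:C%C /\
   forall n : nat, (2 <= n)%N ->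
   is_fracLaplacian alpha (@CH_even R n) x
     (- (2 * n%:R * Gamma (1 + alpha)
         / (1 + x ^+ 2) `^ ((n%:R + alpha) / 2))
      * sin ((n%:R + alpha) * arccot x - pi * alpha / 2)
      * (\sum_(0 <= l < ((n - 1)./2).+1)
           (-1) ^+ l * 'C(n - 1, 2 * l)%:R * x ^+ (n - 1 - 2 * l)
           * hyp2F1 (- (2 * l)%:R) (1 + alpha) 2 2)
      + 2 * n%:R * Gamma (1 + alpha)
         / (1 + x ^+ 2) `^ ((n%:R + alpha) / 2)
      * cos ((n%:R + alpha) * arccot x - pi * alpha / 2)
      * (\sum_(0 <= l < ((n - 2)./2).+1)
           (-1) ^+ l * 'C(n - 1, 2 * l + 1)%:R * x ^+ (n - 2 - 2 * l)
           * hyp2F1 (- (2 * l)%:R - 1) (1 + alpha) 2 2))%:C%C) /\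
  (is_fracLaplacian alpha (@SH_odd R 0) x
     (2 * Gamma (1 + alpha) / (1 + x ^+ 2) `^ ((1 + alpha) / 2)
      * cos ((1 + alpha) * arccot x - pi * alpha / 2))%:C%C /\
   forall n : nat, (1 <= n)%N ->
   is_fracLaplacian alpha (@SH_odd R n) x
     (2 * (n%:R + 1) * Gamma (1 + alpha)
         / (1 + x ^+ 2) `^ ((n%:R + 1 + alpha) / 2)
      * cos ((n%:R + 1 + alpha) * arccot x - pi * alpha / 2)
      * (\sum_(0 <= l < (n./2).+1)
           (-1) ^+ l * 'C(n, 2 * l)%:R * x ^+ (n - 2 * l)
           * hyp2F1 (- (2 * l)%:R) (1 + alpha) 2 2)
      + 2 * (n%:R + 1) * Gamma (1 + alpha)
         / (1 + x ^+ 2) `^ ((n%:R + 1 + alpha) / 2)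
      * sin ((n%:R + 1 + alpha) * arccot x - pi * alpha / 2)
      * (\sum_(0 <= l < ((n - 1)./2).+1)
           (-1) ^+ l * 'C(n, 2 * l + 1)%:R * x ^+ (n - 1 - 2 * l)
           * hyp2F1 (- (2 * l)%:R - 1) (1 + alpha) 2 2))%:C%C).
Proof.
have a0 : 0 < alpha by case/andP: halpha.
split; split; [|split| |].
- have := @is_fracLaplacian_CH _ alpha 0 x halpha.
  by rewrite /fracLaplacian_lambda big_ord0.
- have := @is_fracLaplacian_CH _ alpha 1 x halpha.
  by rewrite Re_lambda_closed// even_sum0 odd_sum0 !mulr1 mulr0 addr0.
- move=> [//|n] _; have := @is_fracLaplacian_CH _ alpha n.+1 x halpha.
  have -> : (n.+1 - 1 = n)%N by lia.
  have -> : (n.+1 - 2 = n - 1)%N by lia.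
  by rewrite Re_lambda_closed.
- have := @is_fracLaplacian_SH _ alpha 0 x halpha.
  by rewrite Im_lambda_closed// even_sum0 odd_sum0 !mulr1 mulr0 addr0.
- move=> n _; have := @is_fracLaplacian_SH _ alpha n x halpha.
  by rewrite Im_lambda_closed// -(natr1 n).
Qed.
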